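(* Let $M_\theta(Q,\mathbf r)$ be a Fano quiver flag variety. Then the set $$\mathcal S(Q)=\{s^1_{\lambda_1}\cdots s^\rho_{\lambda_\rho}\;:\;\lambda_i \text{ is a partition fitting into an } r_i\times(s_i-r_i)\text{ rectangle, } 1\le i\le\rho\}$$ is a basis (over $\mathbb C[q_1,\dots,q_\rho]$) of the small quantum cohomology ring $QH^*(M_\theta(Q,\mathbf r))$. Moreover, if $1\le i\le\rho$ and $\mu=(\mu_1,\dots,\mu_{r_i})$ is a partition too wide to fit into an $r_i\times(s_i-r_i)$ box (that is, $\mu_1\ge s_i-r_i+1$), then in $QH^*(M_\theta(Q,\mathbf r))$ the element $s^i_\mu$ can be expanded as a signed sum of rim-hook removals of $\mu$, $$s^i_\mu=\sum_{n\ge1}P_n\,\mathrm{RH}^n(s^i_\mu)$$ (a finite sum), where each coefficient $P_n$ is a polynomial in the Chern classes of the bundles $W_j$ and the quantum parameters $q_1,\dots,q_\rho$.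
   Context: Quiver flag varieties. $Q=(Q_0,Q_1)$ is a finite acyclic quiver with a unique source; $Q_0=\{0,1,\dots,\rho\}$, $0$ is the source, and the number $n_{ij}$ of arrows from $i$ to $j$ is zero unless $i<j$. For an arrow $a\in Q_1$, $s(a),t(a)$ are its source and target. $\mathbf r=(r_0,\dots,r_\rho)$ is a vector of positive integers with $r_0=1$. Let $\mathrm{Rep}(Q,\mathbf r)=\bigoplus_{a\in Q_1}\mathrm{Hom}(\mathbb C^{r_{s(a)}},\mathbb C^{r_{t(a)}})$, on which $G=\prod_{i=1}^\rho \mathrm{GL}(r_i)$ acts by change of basis. The quiver flag variety $M_\theta(Q,\mathbf r)$ is the GIT quotient $\mathrm{Rep}(Q,\mathbf r)/\!/_\theta G$ with $\theta(g)=\prod_{i=1}^\rho\det(g_i)$. Equivalently it is a tower of Grassmannian bundles: $M_0$ is a point, $W_0$ is the trivial line bundle, and inductively $M_i=\mathrm{Gr}(\bigoplus_{a\in Q_1,t(a)=i}W_{s(a)},r_i)$ is the relative Grassmannian of rank $r_i$ quotients over $M_{i-1}$, with tautological quotient bundle $W_i$ of rank $r_i$; then $M_\theta(Q,\mathbf r)=M_\rho$. Put $s_i=\sum_{a\in Q_1,t(a)=i}r_{s(a)}$ and $s_i'=\sum_{a\in Q_1,s(a)=i}r_{t(a)}$. Standing assumptions: $s_i-r_i>0$ for all $1\le i\le\rho$, and $Q$ is graph-reduced, i.e. there is no graftable subquiver (no subquiver attached to the rest of the quiver only through a single non-source vertex of dimension $1$, which could be moved to the source without changing the variety). For graph-reduced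 quivers the ample cone is the positive orthant in the basis $c_1(W_1),\dots,c_1(W_\rho)$ of $H^2$, and $M_\theta(Q,\mathbf r)$ is Fano if and only if $s_i-s_i'>0$ for all $i$. Small quantum cohomology $QH^*$: $H^*(M_\theta(Q,\mathbf r),\mathbb C)\otimes\mathbb C[q_1,\dots,q_\rho]$ with the product defined by three-point genus-zero Gromov–Witten invariants weighted by $q^d=\prod_iq_i^{d_i}$, $d_i=\int_dc_1(W_i)$. It is presented as $\mathbb C[x_{ij},q_i:1\le i\le\rho,1\le j\le r_i]^W/I_q$, where $W=\prod_i S_{r_i}$ permutes $x_{i1},\dots,x_{ir_i}$ for each $i$ (the Chern roots of $W_i$), $I_q$ is generated by the $W$-invariant $f$ with $\omega f\in I^{ab}_q$, $\omega=\prod_i\prod_{j<k}(x_{ij}-x_{ik})$, and $I_q^{ab}$ is generated by $\prod_{t(a)=i}\prod_{k=1}^{r_{s(a)}}(-x_{s(a)k}+x_{ij})-(-1)^{r_i-1}q_i\prod_{s(a)=i}\prod_{k=1}^{r_{t(a)}}(-x_{ij}+x_{t(a)k})$ for all $i,j$ ($x_{01}=0$). For a partition $\lambda$, $s^i_\lambda$ is the image in this ring of the Schur polynomial of $\lambda$ in $x_{i1},\dots,x_{ir_i}$ (zero if $\lambda$ has more than $r_i$ parts); Chern classes of $W_j$ are the elementary symmetric polynomials in $x_{j1},\dots,x_{jr_j}$. Rim-hooks. The rim-hook of length $n$ of a partition $\lambda$ is the connected path of $n$ boxes in the Young diagram of $\lambda$ starting at the last box of the first row and staying on the rim (the boxes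 having no box of $\lambda$ diagonally south-east of them); it is unique if it exists. The length $n$ rim-hook removal is said to exist if such a path exists and deleting it from $\lambda$ leaves a partition $\lambda'$. The height $h$ is the number of rows met by the path. Set $\mathrm{RH}^n(s_\lambda)=(-1)^{h+1}s_{\lambda'}$ if the removal exists and $0$ otherwise; the same notation is used for $s^i_\lambda$. *)

(* Defs.v *)
From HB Require Import structures.
From mathcomp Require Import all_boot all_order all_algebra all_fingroup.
From mathcomp Require Import generic_quotient ring_quotient.
From mathcomp Require Import boolp reals complex.
From mathcomp Require Import mpoly.

Set Implicit Arguments.
Unset Strict Implicit.
Unset Printing Implicit Defensive.

Import Order.TTheory GRing.Theory Num.Theory.
Local Open Scope ring_scope.

(* Partitions with at most m parts are weakly decreasing m.-tuples of naturals;
   trailing zeros are allowed. *)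

Definition is_partition (l : seq nat) : bool := sorted geq l.

Definition box_partition (m n : nat) : Type :=
  {l : m.-tuple 'I_n.+1 | is_partition (map val l)}.

HB.instance Definition _ m n := Finite.on (box_partition m n).

Definition box_parts m n (l : box_partition m n) : m.-tuple nat :=
  [tuple of map val (val l)].

(* The box (a, b) is in row a and column b, both numbered from 0. *)
Definition in_diagram (l : seq nat) (b : nat * nat) : bool :=
  (b.2 < nth 0%N l b.1)%N.

Definition on_rim (l : seq nat) (b : nat * nat) : bool :=
  in_diagram l b && ~~ in_diagram l (b.1.+1, b.2.+1).

Definition adjacent (b c : nat * nat) : bool :=
  ((b.1 == c.1) && ((b.2.+1 == c.2) || (c.2.+1 == b.2))) ||
  ((b.2 == c.2) && ((b.1.+1 == c.1) || (c.1.+1 == b.1))).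

Definition is_rim_hook (l : seq nat) (n : nat) (p : seq (nat * nat)) : bool :=
  if p is b :: p' then
    [&& size p == n, b == (0%N, (nth 0%N l 0).-1), path adjacent b p', uniq p
      & all (on_rim l) p]
  else false.

(* h is the height, i.e. the number of rows met by the rim-hook. *)
Definition rim_hook_removal m (l : m.-tuple nat) (n : nat)
    (l' : m.-tuple nat) (h : nat) : Prop :=
  exists p : seq (nat * nat),
    [/\ is_rim_hook l n p, is_partition l',
        forall b, in_diagram l' b = in_diagram l b && (b \notin p)
      & h = size (undup (map fst p))].

(* l' and h are determined by l and n, so the choice made by cid is harmless. *)
Definition RH (V : pzRingType) m (s : m.-tuple nat -> V) (n : nat)
    (l : m.-tuple nat) : V :=
  if pselect (exists x, rim_hook_removal l n x.1 x.2) is left ex then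
    let x := projT1 (cid ex) in (-1) ^+ x.2.+1 * s x.1
  else 0.

Section Schur.
Variables (A : idomainType) (m : nat).

Definition alternant (e : 'I_m -> nat) : {mpoly A[m]} :=
  \det (\matrix_(i, j) 'X_j ^+ e i).

Definition delta (i : 'I_m) : nat := (m - i.+1)%N.

Lemma mpoly_root_reduce k : exists c : 'I_m -> {mpoly A[m]},
  forall j : 'I_m, 'X_j ^+ k = \sum_(i < m) c i * 'X_j ^+ i.
Proof.
pose chi : {poly {mpoly A[m]}} := \prod_(i < m) ('X - ('X_i : {mpoly A[m]})%:P).
have mchi : chi \is monic by apply: monic_prod => i _; exact: monicXsubC.
have schi : size chi = m.+1 by rewrite size_prod_XsubC /index_enum -enumT size_enum_ord.
pose p := Pdiv.CommonRing.rmodp 'X^k chi.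
have sp : (size p <= m)%N.
  by rewrite -ltnS -schi; apply: Pdiv.CommonRing.ltn_rmodpN0; rewrite monic_neq0.
exists (fun i => p`_i) => j.
have := congr1 (horner^~ 'X_j) (Pdiv.RingMonic.rdivp_eq mchi 'X^k).
have chi0 : chi.['X_j] = 0.
  by rewrite /chi (bigD1 j) // hornerM hornerXsubC subrr mul0r.
rewrite hornerXn hornerD hornerM chi0 mulr0 add0r => ->.
exact: horner_coef_wide sp.
Qed.

Definition vander : {mpoly A[m]} := alternant (fun i => i : nat).

Lemma vander_dvd e : exists p, alternant e = p * vander.
Proof.
have c_ (i : 'I_m) := cid (mpoly_root_reduce (e i)).
exists (\det (\matrix_(i, j) projT1 (c_ i) j)).
rewrite -det_mulmx; congr (\det _); apply/matrixP => i j; rewrite !mxE.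
rewrite (projT2 (c_ i) j); apply: eq_bigr => k _; by rewrite !mxE.
Qed.

Lemma alternant_delta : exists b : bool, alternant delta = (-1) ^+ b * vander.
Proof.
pose s : 'S_m := perm (@rev_ord_inj m).
exists s; rewrite -det_perm -det_mulmx -row_permE; congr (\det _).
by apply/matrixP => i j; rewrite !mxE /s permE.
Qed.

Lemma alternant_dvd e : exists p, p * alternant delta = alternant e.
Proof.
have [p ->] := vander_dvd e; have [b ->] := alternant_delta.
by exists (p * (-1) ^+ b); rewrite -mulrA; congr (_ * _); rewrite mulrA -signr_addb addbb mul1r.
Qed.

(* The bialternant quotient; alternant delta is the Vandermonde determinant
   prod_(i < j) ('X_i - 'X_j), which is not a zero divisor. *)
Definition schur (l : m.-tuple nat) : {mpoly A[m]} :=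
  projT1 (cid (alternant_dvd (fun i => tnth l i + delta i)%N)).

Lemma schurE l :
  schur l * alternant delta = alternant (fun i => tnth l i + delta i)%N.
Proof. by rewrite /schur; case: cid. Qed.

Lemma alternant_delta_neq0 : alternant delta != 0.
Proof.
have [b ->] := alternant_delta; rewrite mulf_neq0 ?signr_eq0 //.
have -> : vander = \det (Vandermonde m (\row_j ('X_j : {mpoly A[m]}))).
  by congr (\det _); apply/matrixP => i j; rewrite !mxE.
rewrite det_Vandermonde; apply/prodf_neq0 => i _; apply/prodf_neq0 => j ij.
rewrite !mxE subr_eq0; apply/eqP => /mpolyP /(_ U_(j)%MM).
rewrite !mcoeffX eqxx; case: eqP => [/mnmP /(_ j)|_ /eqP].
  by rewrite !mnm1E eqxx (negbTE (_ : i != j)) ?neq_ltn ?ij.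
by rewrite oner_eq0.
Qed.

Lemma msym_alternant (s : 'S_m) e : msym s (alternant e) = (-1) ^+ s * alternant e.
Proof.
rewrite /alternant -det_map_mx; set M := \matrix_(i, j) _.
have -> : map_mx (msym s) M = col_perm s M.
  by apply/matrixP => i j; rewrite !mxE rmorphXn /= /msym mmapX mmap1U.
by rewrite col_permE det_mulmx det_perm odd_permV mulrC.
Qed.

Lemma schur_sym l : schur l \is symmetric.
Proof.
apply/issymP => s; apply: (mulIf alternant_delta_neq0).
have := congr1 (msym s) (schurE l); rewrite rmorphM /= !msym_alternant -schurE.
by rewrite mulrCA => /(mulfI (negbT (signr_eq0 _ _))).
Qed.

End Schur.

Lemma msym_comp (A : comNzRingType) m k (s : 'S_k) (t : 'S_m) (f : 'I_m -> 'I_k)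
    (p : {mpoly A[m]}) :
  (forall j, s (f j) = f (t j)) ->
  msym s (p \mPo [tuple 'X_(f j) | j < m]) =
  msym t p \mPo [tuple 'X_(f j) | j < m].
Proof.
move=> sf; elim/mpolyind: p => [|c u p _ _ ih].
  by rewrite !(comp_mpoly0, msym0).
rewrite comp_mpolyD !msymD comp_mpolyD ih; congr (_ + _).
rewrite comp_mpolyZ !msymZ comp_mpolyZ; congr (_ *: _).
rewrite comp_mpolyX msymX comp_mpolyX rmorph_prod /= [RHS](reindex_inj (@perm_inj _ t)).
apply: eq_bigr => j _; rewrite rmorphXn /= !tnth_mktuple mnmE permK.
by rewrite /msym mmapX mmap1U sf.
Qed.

Record quiver := Quiver {
  rho : nat;
  arrow : finType;
  src : arrow -> 'I_rho.+1;
  tgt : arrow -> 'I_rho.+1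
}.
Arguments src {q}.
Arguments tgt {q}.

Notation vertex Q := 'I_(rho Q).+1.

(* The non-source vertices 1, ..., rho are the vtx i with i : 'I_rho; vtx i is
   the vertex numbered i.+1. *)
Notation vtx i := (lift ord0 i).

Section QuiverConditions.
Variables (Q : quiver) (r : vertex Q -> nat).

Definition ordered_acyclic : Prop := forall a : arrow Q, (src a < tgt a)%N.

Definition unique_source : Prop :=
  forall i : vertex Q, (forall a : arrow Q, tgt a != i) <-> i = ord0.

Definition s_in (i : vertex Q) : nat := (\sum_(a | tgt a == i) r (src a))%N.

Definition s_out (i : vertex Q) : nat := (\sum_(a | src a == i) r (tgt a))%N.

(* J is the set of vertices, other than i, of a subquiver that is attached to
   the rest of the quiver only through i. *)
Definition graftable (i : vertex Q) (J : {set vertex Q}) : Prop :=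
  [/\ i != ord0, r i = 1%N, J != finset.set0, (ord0 \notin J) && (i \notin J)
    & forall a : arrow Q,
        (src a \in J) != (tgt a \in J) -> (src a == i) || (tgt a == i)].

Definition graph_reduced : Prop := forall i J, ~ graftable i J.

(* A class in H^2 is given by its coordinates in c_1(W_1), ..., c_1(W_rho).
   The anticanonical character of Rep(Q, r) // G is the determinant of the sum
   of the Hom(W_(src a), W_(tgt a)), whose weight at i is s_i - s'_i. The ample
   cone is the positive orthant because Q is graph-reduced. *)
Definition anticanonical (i : 'I_(rho Q)) : int :=
  (s_in (vtx i))%:Z - (s_out (vtx i))%:Z.

Definition ample (d : 'I_(rho Q) -> int) : Prop := forall i, 0 < d i.

Definition fano : Prop := ample anticanonical.

End QuiverConditions.

Section QuantumCohomology.
Variables (R : realType) (Q : quiver) (r : vertex Q -> nat).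

Definition Cq : idomainType := {mpoly R[i][rho Q]}.

(* The pair (i, k) stands for the Chern root x_(i+1, k+1) of the bundle at vtx i. *)
Definition root_index : finType := {i : 'I_(rho Q) & 'I_(r (vtx i))}.

Local Notation Cxq := {mpoly Cq[#|root_index|]}.

Definition root_rank (i : 'I_(rho Q)) (k : 'I_(r (vtx i))) : 'I_#|root_index| :=
  enum_rank (Tagged (fun i => 'I_(r (vtx i))) k : root_index).

Definition root_var i k : Cxq := 'X_(@root_rank i k).

Definition qvar (i : 'I_(rho Q)) : Cxq := ('X_i : Cq)%:MP.

Definition chern_roots (v : vertex Q) : seq Cxq :=
  if unlift ord0 v is Some i then [seq root_var k | k <- enum 'I_(r (vtx i))]
  else [:: 0].

Definition qrel (i : 'I_(rho Q)) (j : 'I_(r (vtx i))) : Cxq :=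
  \prod_(a | tgt a == vtx i) \prod_(y <- chern_roots (src a)) (root_var j - y)
  - (-1) ^+ (r (vtx i)).-1 * qvar i *
    \prod_(a | src a == vtx i) \prod_(y <- chern_roots (tgt a)) (y - root_var j).

Definition Iab (f : Cxq) : Prop :=
  exists c : root_index -> Cxq,
    f = \sum_(v : root_index) c v * qrel (tagged v).

Definition omega : Cxq :=
  \prod_(i < rho Q) \prod_(j < r (vtx i)) \prod_(k < r (vtx i) | (j < k)%N)
    (root_var j - root_var k).

Definition Wgroup (s : 'S_#|root_index|) : bool :=
  [forall v, tag (enum_val (s v)) == tag (enum_val v)].

Definition W_invariant : {pred Cxq} :=
  fun f => [forall s, Wgroup s ==> (msym s f == f)].

Lemma W_invariantP f :
  reflect (forall s, Wgroup s -> msym s f = f) (f \in W_invariant).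
Proof.
apply: (iffP forallP) => h s; first by move=> Ws; exact/eqP/(implyP (h s) Ws).
by apply/implyP => Ws; apply/eqP/h.
Qed.

Lemma W_invariant_subalg : subalg_closed W_invariant.
Proof.
split=> [|c f g /W_invariantP hf /W_invariantP hg
         |f g /W_invariantP hf /W_invariantP hg];
  apply/W_invariantP => s Ws.
- exact: rmorph1.
- by rewrite msymD msymZ hf ?hg.
- by rewrite msymM hf ?hg.
Qed.
HB.instance Definition _ :=
  GRing.isSubalgClosed.Build Cq Cxq W_invariant W_invariant_subalg.

Record CxqW : Type := InvPoly { inv_val : Cxq; _ : inv_val \in W_invariant }.
HB.instance Definition _ := [isSub for inv_val].
HB.instance Definition _ := [Choice of CxqW by <:].
HB.instance Definition _ := [SubChoice_isSubComNzRing of CxqW by <:].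
HB.instance Definition _ := [SubZmodule_isSubLmodule of CxqW by <:].
HB.instance Definition _ := [SubNzRing_SubLmodule_isSubLalgebra of CxqW by <:].
HB.instance Definition _ := [SubLalgebra_isSubAlgebra of CxqW by <:].

Definition Iq : {pred CxqW} := fun f => `[< Iab (omega * inv_val f) >].

Lemma Iab0 : Iab 0.
Proof. by exists (fun=> 0); rewrite big1 // => v _; rewrite mul0r. Qed.

Lemma IabB f g : Iab f -> Iab g -> Iab (f - g).
Proof.
case=> c -> [d ->]; exists (fun v => c v - d v); rewrite -sumrB.
by apply: eq_bigr => v _; rewrite mulrBl.
Qed.

Lemma IabM u f : Iab f -> Iab (u * f).
Proof.
case=> c ->; exists (fun v => u * c v); rewrite mulr_sumr.
by apply: eq_bigr => v _; rewrite mulrA.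
Qed.

Lemma Iq_zmod : zmod_closed Iq.
Proof.
split; first by apply/asboolP; rewrite mulr0; exact: Iab0.
move=> f g /asboolP hf /asboolP hg; apply/asboolP.
have -> : omega * inv_val (f - g) = omega * inv_val f - omega * inv_val g.
  exact: mulrBr.
exact: IabB.
Qed.
HB.instance Definition _ := GRing.isZmodClosed.Build CxqW Iq Iq_zmod.

(* Iq is the whole set of invariants f with omega * f in Iab; it is already an
   ideal, so it is the ideal that these f generate. *)
Lemma IqM (u f : CxqW) : f \in Iq -> u * f \in Iq.
Proof. by move=> /asboolP hf; apply/asboolP; rewrite mulrCA; exact: IabM. Qed.

Lemma IqZ (c : Cq) (f : CxqW) : f \in Iq -> c *: f \in Iq.
Proof. by move=> hf; rewrite -mulr_algl IqM. Qed.

(* QH^* through its presentation: Gromov-Witten invariants are not available.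
   It is kept as a possibly trivial ring, since 1 \notin Iq is not proved. *)
Definition QH : Type := Quotient.quot Iq.
HB.instance Definition _ := GRing.Zmodule.on QH.
HB.instance Definition _ := EqQuotient.on QH.

Definition qclass (f : CxqW) : QH := \pi_QH%qT f.

Lemma qclass_eq f g : (qclass f = qclass g) <-> (f - g \in Iq).
Proof. by rewrite Quotient.idealrBE; split=> [/eqP|/eqP]. Qed.

Lemma qclass_surj (x : QH) : exists f, x = qclass f.
Proof. by exists (repr x); rewrite /qclass reprK. Qed.

Lemma qclassD : {morph qclass : f g / f + g}.
Proof. exact: raddfD. Qed.

Definition qh_one : QH := qclass 1.
Definition qh_mul (x y : QH) : QH := qclass (repr x * repr y).
Definition qh_scale (c : Cq) (x : QH) : QH := qclass (c *: repr x).

Lemma repr_qclass f : repr (qclass f) - f \in Iq.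
Proof. by apply/qclass_eq; rewrite /qclass reprK. Qed.

Lemma qh_mulE f g : qh_mul (qclass f) (qclass g) = qclass (f * g).
Proof.
apply/qclass_eq; set f' := repr _; set g' := repr _.
rewrite (_ : _ - _ = f' * (g' - g) + g * (f' - f)); last first.
  by rewrite !mulrBr [g * f']mulrC [g * f]mulrC addrA subrK.
by rewrite rpredD ?IqM ?repr_qclass.
Qed.

Lemma qh_scaleE c f : qh_scale c (qclass f) = qclass (c *: f).
Proof. by apply/qclass_eq; rewrite -scalerBr IqZ ?repr_qclass. Qed.

Lemma qh_mulA : associative qh_mul.
Proof.
move=> x y z; have [f ->] := qclass_surj x; have [g ->] := qclass_surj y.
by have [h ->] := qclass_surj z; rewrite !qh_mulE mulrA.
Qed.

Lemma qh_mulC : commutative qh_mul.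
Proof. by move=> x y; rewrite /qh_mul mulrC. Qed.

Lemma qh_mul1 : left_id qh_one qh_mul.
Proof. by move=> x; have [f ->] := qclass_surj x; rewrite qh_mulE mul1r. Qed.

Lemma qh_mulDl : left_distributive qh_mul +%R.
Proof.
move=> x y z; have [f ->] := qclass_surj x; have [g ->] := qclass_surj y.
have [h ->] := qclass_surj z.
by rewrite -qclassD !qh_mulE mulrDl qclassD.
Qed.

HB.instance Definition _ :=
  GRing.Zmodule_isComPzRing.Build QH qh_mulA qh_mulC qh_mul1 qh_mulDl.

Lemma qh_scaleA a b x : qh_scale a (qh_scale b x) = qh_scale (a * b) x.
Proof. by have [f ->] := qclass_surj x; rewrite !qh_scaleE scalerA. Qed.

Lemma qh_scale1 : left_id 1 qh_scale.
Proof. by move=> x; have [f ->] := qclass_surj x; rewrite qh_scaleE scale1r. Qed.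

Lemma qh_scaleDr : right_distributive qh_scale +%R.
Proof.
move=> a x y; have [f ->] := qclass_surj x; have [g ->] := qclass_surj y.
by rewrite -qclassD !qh_scaleE scalerDr qclassD.
Qed.

Lemma qh_scaleDl x : {morph qh_scale^~ x : a b / a + b}.
Proof.
by move=> a b; have [f ->] := qclass_surj x; rewrite !qh_scaleE scalerDl qclassD.
Qed.

HB.instance Definition _ :=
  GRing.Zmodule_isLmodule.Build Cq QH qh_scaleA qh_scale1 qh_scaleDr qh_scaleDl.

Lemma qh_scaleAl (a : Cq) (x y : QH) : a *: (x * y) = a *: x * y.
Proof.
have [f ->] := qclass_surj x; have [g ->] := qclass_surj y.
change (qh_scale a (qh_mul (qclass f) (qclass g)) =
  qh_mul (qh_scale a (qclass f)) (qclass g)).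
by rewrite !(qh_mulE, qh_scaleE) scalerAl.
Qed.

Lemma qclass_monoid_morphism : monoid_morphism qclass.
Proof. by split=> [|f g]; last exact/esym/qh_mulE. Qed.
HB.instance Definition _ := GRing.isZmodMorphism.Build CxqW QH qclass
  (raddfB \pi_QH%qT).
HB.instance Definition _ :=
  GRing.isMonoidMorphism.Build CxqW QH qclass qclass_monoid_morphism.

Lemma qclass_scalable : scalable qclass.
Proof. by move=> c f; exact/esym/qh_scaleE. Qed.
HB.instance Definition _ :=
  GRing.isScalable.Build Cq CxqW QH *:%R qclass qclass_scalable.

(* The substitution of x_(i1), ..., x_(i r_i) in a polynomial in r_i variables *)
Definition in_roots (i : 'I_(rho Q)) (p : {mpoly Cq[r (vtx i)]}) : Cxq :=
  p \mPo [tuple root_var k | k < r (vtx i)].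

Lemma in_roots_invariant i (p : {mpoly Cq[r (vtx i)]}) :
  p \is symmetric -> in_roots p \in W_invariant.
Proof.
move=> /issymP psym; apply/W_invariantP => s /forallP Ws.
pose sv (k : 'I_(r (vtx i))) := enum_val (s (root_rank k)) : root_index.
have tag_sv k : i = tag (sv k).
  by rewrite (eqP (Ws (root_rank k))) enum_rankK.
pose t k : 'I_(r (vtx i)) :=
  cast_ord (congr1 (fun i => r (vtx i)) (esym (tag_sv k))) (tagged (sv k)).
have tE k : s (root_rank k) = root_rank (t k).
  apply: enum_val_inj; rewrite enum_rankK -/(sv k) /t.
  case: (sv k) (tag_sv k) => i' k' /= e; move: e k'; case: i' / => k'.
  by congr Tagged; apply: val_inj.
have rank_inj : injective (@root_rank i).
  by move=> k l /enum_rank_inj /eqP; rewrite eq_Tagged => /eqP.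
have t_inj : injective t.
  move=> k l tkl; apply/rank_inj/(@perm_inj _ s).
  by rewrite !tE tkl.
rewrite -[in RHS](psym (perm t_inj)) /in_roots.
by apply: msym_comp => k; rewrite permE.
Qed.

Definition sym_in_roots i (p : {mpoly Cq[r (vtx i)]}) (psym : p \is symmetric) :
  CxqW := InvPoly (in_roots_invariant psym).

Definition schurQ (i : 'I_(rho Q)) (l : (r (vtx i)).-tuple nat) : QH :=
  qclass (sym_in_roots (schur_sym Cq l)).

(* The (k+1)-st Chern class of the bundle at vtx i *)
Definition chernW (i : 'I_(rho Q)) (k : 'I_(r (vtx i))) : CxqW :=
  sym_in_roots (mesym_sym (r (vtx i)) Cq k.+1).

(* The value in QH of a polynomial in the quantum parameters (its coefficients)
   and the Chern classes of the bundles (its variables) *)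
Definition chern_eval (P : {mpoly Cq[#|root_index|]}) : QH :=
  qclass (mmap (in_alg CxqW) (fun v => chernW (tagged (enum_val v))) P).

Definition box_family : finType :=
  {dffun forall i : 'I_(rho Q),
     box_partition (r (vtx i)) (s_in r (vtx i) - r (vtx i))}.

Definition schur_product (l : box_family) : QH :=
  \prod_i schurQ (box_parts (l i)).

End QuantumCohomology.

Definition is_basis (A : nzRingType) (V : lmodType A) (T : finType) (b : T -> V) :
  Prop := forall v, exists! c : {ffun T -> A}, v = \sum_t c t *: b t.

(* Main.v *)
(* With the roots x_j of block i weighted by M + i for a large constant M, the
   Fano condition makes x_ij^(s_i) the leading term of the relation at (i, j).
   These leading terms are powers of distinct variables, so the monomials of
   degree < s_i in every x_ij form a C[q]-basis of the quotient by I^ab.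
   Multiplication by omega turns I_q into the antisymmetric part of I^ab, and
   antisymmetrizing the monomial basis block by block leaves, up to sign, the
   alternants omega * prod_i s^i_(lambda_i) with lambda_i in the box.

   For the rim-hook expansion, the relation at (i, j) says that x_ij is a root of
   a monic polynomial of degree s_i which does not depend on j and has coefficients
   polynomial in Chern classes and q. Applied to the first row of the alternant of
   mu + delta, it lowers the first exponent mu_1 + r_i - 1 by n = 1, ..., s_i.
   Sorting the exponents afterwards is the removal of the rim-hook of length n. *)

Require Import Defs.
From HB Require Import structures.
From mathcomp Require Import all_boot all_order all_algebra all_fingroup.
From mathcomp Require Import boolp reals complex.
From mathcomp Require Import mpoly.
From mathcomp Require Import zify ring.

Set Implicit Arguments.
Unset Strict Implicit.
Unset Printing Implicit Defensive.

Import GRing.Theory.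
Local Open Scope ring_scope.

(** * Ideals with leading terms that are powers of distinct variables *)

(** The theorem concerns a quotient, but the computations are made with polynomials: a class in [QH]
    is studied through its multiple by omega, since [Iq] is defined by that multiple lying in [Iab].
    The quantum parameters stay in the coefficient ring and have weight zero, so spanning and
    freeness come out directly over the polynomials in q. For freeness, box alternants have all
    exponents below s_i, so a combination of them that lies in [Iab] already vanishes as a
    polynomial. Spanning uses that [Iab] is stable under W and that the factorials of the r_i are
    invertible. For rim-hooks the obstacle is their definition by paths of boxes. Contents translate
    it into the exponents lambda + delta: a hook of length n runs through the contents from the
    first exponent minus 1 down to the first exponent minus n. Its removal fails to exist only when
    the lowered exponent coincides with another one, and then the alternant vanishes. *)

Section WeightedLeadingTerms.
Variables (A : comNzRingType) (n : nat) (w : 'I_n -> nat).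
Local Notation MP := {mpoly A[n]}.

Definition wt (m : 'X_{1..n}) : nat := (\sum_v m v * w v)%N.

Lemma wtD m m' : wt (m + m')%MM = (wt m + wt m')%N.
Proof. by rewrite -big_split; apply: eq_bigr => v _; rewrite mnmDE mulnDl. Qed.

Lemma wt0 : wt 0%MM = 0%N.
Proof. by rewrite /wt big1 // => v _; rewrite mnm0E. Qed.

Lemma wtU v : wt U_(v)%MM = w v.
Proof.
rewrite /wt (bigD1 v) //= mnm1E eqxx mul1n big1 ?addn0 // => u uv.
by rewrite mnm1E eq_sym (negbTE uv).
Qed.

Lemma wtMn m k : wt (m *+ k)%MM = (k * wt m)%N.
Proof.
elim: k => [|k ih]; first by rewrite mulm0n wt0.
by rewrite mulmS wtD ih mulSn.
Qed.

(** The strict bound makes [wlt 0] consist of zero alone, the base case of the inductions on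
    weight. *)
Definition wlt (d : nat) : {pred MP} :=
  fun p => all (fun m => (wt m < d)%N) (msupp p).

Lemma wltP d p :
  reflect (forall m, p@_m != 0 -> (wt m < d)%N) (p \in wlt d).
Proof.
apply: (iffP allP) => h m; first by rewrite -mcoeff_msupp; exact: h.
by rewrite mcoeff_msupp; exact: h.
Qed.

Lemma wlt_zmod d : zmod_closed (wlt d).
Proof.
split=> [|p q /wltP hp /wltP hq]; first by rewrite /wlt unfold_in msupp0.
apply/wltP => m; rewrite mcoeffB; have [->|/hp //] := eqVneq p@_m 0.
by rewrite sub0r oppr_eq0 => /hq.
Qed.
HB.instance Definition _ d := GRing.isZmodClosed.Build MP (wlt d) (wlt_zmod d).

Lemma wltZ d c p : p \in wlt d -> c *: p \in wlt d.
Proof.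
move=> /wltP hp; apply/wltP => m; rewrite mcoeffZ => h; apply: hp.
by apply: contraNneq h => ->; rewrite mulr0.
Qed.

Lemma wltW d d' p : (d <= d')%N -> p \in wlt d -> p \in wlt d'.
Proof. by move=> le /wltP hp; apply/wltP => m /hp lt; exact: leq_trans le. Qed.

Lemma wltX m d : ('X_[m] \in wlt d) = (wt m < d)%N.
Proof. by rewrite /wlt unfold_in msuppX /= andbT. Qed.

Lemma wlt_total p : exists d, p \in wlt d.
Proof.
exists (\max_(m <- msupp p) (wt m).+1)%N; apply/allP => m pm.
exact: (@leq_bigmax_seq _ _ xpredT (fun m => (wt m).+1)).
Qed.

Lemma wltM a b p q : p \in wlt a -> q \in wlt b.+1 -> p * q \in wlt (a + b).
Proof.
move=> hp hq; apply/allP => m /msuppM_le /allpairsP [[m1 m2] /= [h1 h2 ->]].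
have := allP hp _ h1; have := allP hq _ h2; rewrite wtD; lia.
Qed.

(** Distinct monomials may share a weight, so this also excludes other monomials of the weight of
    [m]. *)
Definition lead_monic (p : MP) (m : 'X_{1..n}) := p - 'X_[m] \in wlt (wt m).

Lemma lead_monic_wlt p m : lead_monic p m -> p \in wlt (wt m).+1.
Proof.
move=> h; rewrite -(subrK 'X_[m] p) rpredD ?wltX //.
exact: wltW h.
Qed.

Lemma lead_monicX m : lead_monic 'X_[m] m.
Proof. by rewrite /lead_monic subrr rpred0. Qed.

Lemma lead_monic1 : lead_monic 1 0%MM.
Proof. by rewrite -mpolyX0; exact: lead_monicX. Qed.

Lemma lead_monicM p q m m' :
  lead_monic p m -> lead_monic q m' -> lead_monic (p * q) (m + m')%MM.
Proof.
move=> hp hq; rewrite /lead_monic mpolyXD wtD.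
have -> : p * q - 'X_[m] * 'X_[m'] =
  (p - 'X_[m]) * q + (q - 'X_[m']) * 'X_[m] by ring.
rewrite rpredD //; first by apply: wltM => //; exact: lead_monic_wlt.
by rewrite addnC wltM // wltX.
Qed.

Lemma lead_monic_prod (I : Type) (l : seq I) (P : pred I) (p : I -> MP) m :
  (forall i, P i -> lead_monic (p i) (m i)) ->
  lead_monic (\prod_(i <- l | P i) p i) (\big[mnm_add/0%MM]_(i <- l | P i) m i).
Proof.
by move=> h; apply: (big_ind2 lead_monic) => //; [exact: lead_monic1|move=> ?????; exact: lead_monicM].
Qed.

Lemma lead_monicXn p m k : lead_monic p m -> lead_monic (p ^+ k) (m *+ k)%MM.
Proof.
move=> h; elim: k => [|k ih]; first by rewrite expr0 mulm0n; exact: lead_monic1.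
by rewrite exprS mulmS; exact: lead_monicM.
Qed.

Section Ideal.
Variables (F : 'I_n -> MP) (s : 'I_n -> nat).
Hypothesis s_gt0 : forall v, (0 < s v)%N.
Hypothesis F_lead : forall v, lead_monic (F v) (U_(v) *+ s v)%MM.

Definition reduced : {pred MP} :=
  fun p => all (fun m : 'X_{1..n} => [forall v, (m v < s v)%N]) (msupp p).

Lemma reducedP p :
  reflect (forall m, p@_m != 0 -> forall v, (m v < s v)%N) (p \in reduced).
Proof.
apply: (iffP allP) => h m; first by rewrite -mcoeff_msupp => /h /forallP.
by rewrite mcoeff_msupp => /h ?; apply/forallP.
Qed.

Definition divided_monomial (m : 'X_{1..n}) : MP :=
  \prod_v (F v ^+ (m v %/ s v) * 'X_v ^+ (m v %% s v)).

Lemma lead_divided_monomial m : lead_monic (divided_monomial m) m.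
Proof.
rewrite {2}[m]multinomUE_id.
rewrite /divided_monomial.
apply: lead_monic_prod => v _.
have -> : (U_(v) *+ m v = U_(v) *+ s v *+ (m v %/ s v) + U_(v) *+ (m v %% s v))%MM.
  apply/mnmP => u; rewrite !(mnmDE, mulmnE) -mulnA -mulnDr.
  by rewrite [(s v * _)%N]mulnC -divn_eq.
by apply: lead_monicM; apply: lead_monicXn => //; exact: lead_monicX.
Qed.

(* Unitriangular for the weight, hence bijective; since it turns multiplication by
   x_v ^+ s v into multiplication by F v, the ideal is the image of the combinations
   of non-reduced monomials. *)
Definition division (p : MP) : MP :=
  \sum_(m <- msupp p) p@_m *: divided_monomial m.

Lemma divisionE (l : seq 'X_{1..n}) p : uniq l -> {subset msupp p <= l} ->
  division p = \sum_(m <- l) p@_m *: divided_monomial m.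
Proof.
move=> ul pl; rewrite [RHS](bigID (fun m => m \in msupp p)) /=.
rewrite [X in _ + X]big1 ?addr0 => [|m]; last first.
  by rewrite -mcoeff_eq0 => /eqP ->; rewrite scale0r.
rewrite -big_filter /division; apply: perm_big; apply: uniq_perm.
- exact: msupp_uniq.
- exact: filter_uniq.
by move=> m; rewrite mem_filter andb_idr //; exact: pl.
Qed.

Lemma division_is_linear : linear division.
Proof.
move=> c p q; set l := undup (msupp p ++ msupp q).
have ul : uniq l by exact: undup_uniq.
rewrite !(@divisionE l) // => [|m mq|m mp|m].
- rewrite scaler_sumr -big_split; apply: eq_bigr => m _ /=.
  by rewrite mcoeffD mcoeffZ scalerDl scalerA.
- by rewrite mem_undup mem_cat mq orbT.
- by rewrite mem_undup mem_cat mp.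
move=> /msuppD_le; rewrite mem_undup !mem_cat => /orP[/msuppZ_le ->//|->].
exact: orbT.
Qed.
HB.instance Definition _ :=
  GRing.isLinear.Build A MP MP *:%R division division_is_linear.

Lemma divisionX m : division 'X_[m] = divided_monomial m.
Proof. by rewrite /division msuppX big_seq1 mcoeffX eqxx scale1r. Qed.

Lemma division_lead d p : p \in wlt d.+1 -> division p - p \in wlt d.
Proof.
move=> hp; rewrite {2}[p]mpolyE /division -sumrB big_seq rpred_sum // => m pm.
rewrite -scalerBr wltZ //; apply: wltW (lead_divided_monomial m).
by have := allP hp _ pm.
Qed.

(** [division p - p] has smaller weight than [p]; by induction it has a preimage, and subtracting
    that from [p] gives the one sought. *)
Lemma division_surj p : exists q, division q = p.
Proof.
have [d] := wlt_total p; elim: d p => [|d ih] p hp.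
  exists p; move/allP: hp => hp; rewrite (_ : p = 0) ?linear0 //.
  by apply/eqP; rewrite -msupp_eq0; case: (msupp p) hp => // m l /(_ m (mem_head _ _)).
have [q qE] := ih _ (division_lead hp).
by exists (p - q); rewrite linearB /= qE; ring.
Qed.

Lemma division_inj p : division p = 0 -> p = 0.
Proof.
have [d] := wlt_total p; elim: d => [|d ih] hp p0.
  by move/allP: hp => hp; apply/eqP; rewrite -msupp_eq0; case: (msupp p) hp => // m l /(_ m (mem_head _ _)).
by apply: ih (p0); have := division_lead hp; rewrite p0 sub0r rpredN.
Qed.

Lemma division_reduced p : p \in reduced -> division p = p.
Proof.
move=> hp; rewrite {2}[p]mpolyE /division; apply: eq_big_seq => m pm.
congr (_ *: _); rewrite mpolyXE_id; apply: eq_bigr => v _.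
have /forallP/(_ v) lt := allP hp _ pm.
by rewrite divn_small // modn_small // expr0 mul1r.
Qed.

Lemma divisionM v p : division ('X_v ^+ s v * p) = F v * division p.
Proof.
rewrite [p]mpolyE mulr_sumr !linear_sum mulr_sumr; apply: eq_bigr => m _ /=.
rewrite -scalerAr !linearZ /= -scalerAr; congr (_ *: _).
rewrite mpolyXn -mpolyXD !divisionX /divided_monomial.
rewrite (bigD1 v) //= [in RHS](bigD1 v) //= !mulrA; congr (_ * _).
  rewrite !mnmDE mulmnE mnm1E eqxx mul1n.
  by rewrite -[X in (X + _)%N]mul1n divnMDl // modnMDl exprS.
apply: eq_bigr => u uv.
by rewrite mnmDE mulmnE mnm1E eq_sym (negbTE uv) mul0n add0n.
Qed.

Definition in_ideal (f : MP) := exists c : 'I_n -> MP, f = \sum_v c v * F v.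

Lemma in_ideal0 : in_ideal 0.
Proof. by exists (fun=> 0); rewrite big1 // => v _; rewrite mul0r. Qed.

Lemma in_idealD f g : in_ideal f -> in_ideal g -> in_ideal (f + g).
Proof.
case=> c -> [d ->]; exists (fun v => c v + d v); rewrite -big_split.
by apply: eq_bigr => v _ /=; rewrite mulrDl.
Qed.

Lemma in_idealM f g : in_ideal f -> in_ideal (g * f).
Proof.
case=> c ->; exists (fun v => g * c v); rewrite mulr_sumr.
by apply: eq_bigr => v _ /=; rewrite mulrA.
Qed.

Lemma in_ideal_gen v g : in_ideal (g * F v).
Proof.
apply: in_idealM; exists (fun u => (u == v)%:R).
rewrite (bigD1 v) //= eqxx mul1r big1 ?addr0 // => u /negbTE ->.
by rewrite mul0r.
Qed.

(** [division] fixes [f] and is injective, so writing the ideal element as an image under [division]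
    exhibits [f] itself as a combination of the ['X_v ^+ s v]. No monomial of such a combination is
    reduced. *)
Lemma ideal_reduced0 f : in_ideal f -> f \in reduced -> f = 0.
Proof.
move=> [c fE] fred; have {}fE : f = \sum_v 'X_v ^+ s v * projT1 (cid (division_surj (c v))).
  apply/eqP; rewrite -subr_eq0; apply/eqP/division_inj.
  rewrite linearB /= division_reduced // [X in X - _]fE [division (\sum_v _)]linear_sum -sumrB big1 // => v _.
  by rewrite /= divisionM (projT2 (cid (division_surj (c v)))) mulrC subrr.
apply/mpolyP => m; rewrite mcoeff0; apply/eqP; apply: contraT => fm.
have /reducedP /(_ m fm) m_red := fred; move: fm; rewrite fE raddf_sum big1 ?eqxx //= => v _.
set d := sval _; apply/eqP; rewrite mulrC mpolyXn mcoeff_eq0.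
apply/negP => /msuppM_le /allpairsP [[m1 m2] /= [_]].
rewrite msuppX inE => /eqP -> mE; have := m_red v.
by rewrite mE mnmDE mulmnE mnm1E eqxx mul1n ltnNge leq_addl.
Qed.

(** Take a preimage [p] of [f] under [division]: the reduced monomials of [p] are fixed and form
    [g], the others are sent into the ideal. *)
Lemma ideal_reduce f : exists2 g, g \in reduced & in_ideal (f - g).
Proof.
have [p <-] := division_surj f; rewrite [p]mpolyE linear_sum /=.
elim/big_ind: _ => [|f1 f2 [g1 r1 i1] [g2 r2 i2]|m _].
- exists 0; last by rewrite subr0; exact: in_ideal0.
  by apply/reducedP => m; rewrite mcoeff0 eqxx.
- exists (g1 + g2); last by rewrite opprD addrACA; exact: in_idealD.
  apply/reducedP => m; rewrite mcoeffD; have [->|/(reducedP _ r1) //] := eqVneq g1@_m 0.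
  by rewrite add0r => /(reducedP _ r2).
rewrite linearZ /=; case: (boolP [forall v, m v < s v]%N) => [red|].
  have mred : p@_m *: 'X_[m] \in reduced.
    by apply/allP => m' /msuppZ_le; rewrite msuppX inE => /eqP ->.
  exists (p@_m *: 'X_[m]) => //; rewrite -linearZ /= division_reduced // subrr.
  exact: in_ideal0.
rewrite negb_forall => /existsP [v]; rewrite -leqNgt => sm.
exists 0; first by apply/reducedP => m'; rewrite mcoeff0 eqxx.
rewrite subr0 -mul_mpolyC; apply: in_idealM.
have -> : m = (U_(v) *+ s v + (m - U_(v) *+ s v))%MM.
  rewrite addmC submK //; apply/mnm_lepP => u; rewrite mulmnE mnm1E.
  by case: eqP => [<-|]; rewrite ?mul1n.
by rewrite mpolyXD -mpolyXn divisionM mulrC; exact: in_ideal_gen.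
Qed.

End Ideal.
End WeightedLeadingTerms.

(** * Alternants *)

Lemma decreasing_gap m (f : 'I_m -> nat) :
  (forall i j : 'I_m, (i < j)%N -> (f j < f i)%N) ->
  forall i j : 'I_m, (i <= j)%N -> (f j + (j - i) <= f i)%N.
Proof.
move=> dec i j; move def_k: (j - i)%N => k; elim: k j def_k => [|k ih] j.
  by move=> ji ij; rewrite (_ : j = i) ?addn0 //; apply: val_inj => /=; lia.
move=> ji ij; have hj : (j.-1 < m)%N by have := ltn_ord j; lia.
have /= := ih (Ordinal hj); have /= := dec (Ordinal hj) j; lia.
Qed.

(** An increasing permutation dominates the identity pointwise, and the inverse is increasing as
    well. *)
Lemma increasing_perm_id m (s : 'S_m) :
  (forall i j : 'I_m, (i < j)%N -> (s i < s j)%N) -> s = 1%g.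
Proof.
have le_inc (t : 'S_m) : (forall i j : 'I_m, (i < j)%N -> (t i < t j)%N) ->
    forall i : 'I_m, (i <= t i)%N.
  move=> inc i; have m_gt0 : (0 < m)%N by exact: leq_ltn_trans (ltn_ord i).
  have dec (a b : 'I_m) : (a < b)%N -> (m - t b < m - t a)%N.
    by move=> /inc; have := ltn_ord (t b); lia.
  by have /= := decreasing_gap dec (leq0n i : Ordinal m_gt0 <= i)%N; have := ltn_ord (t i); lia.
move=> inc; have inc' (i j : 'I_m) : (i < j)%N -> ((s^-1)%g i < (s^-1)%g j)%N.
  move=> ij; rewrite ltnNge; apply/negP; rewrite leq_eqVlt => /predU1P [/val_inj /perm_inj e|/inc].
    by rewrite e ltnn in ij.
  by rewrite !permKV ltnNge ltnW.
apply/permP => i; rewrite perm1; apply/val_inj/eqP; rewrite eqn_leq le_inc // andbT.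
by have := le_inc _ inc' (s i); rewrite permK.
Qed.

(** Cofactors along the first row do not see that row, so one family [c], computed here with
    exponent 0, serves every [k]. *)
Lemma det_powers_expand_row0 (B : comNzRingType) m (x : 'I_m -> B) (e : 'I_m -> nat) :
  (0 < m)%N -> exists c : 'I_m -> B, forall k,
    \det (\matrix_(i, j) x j ^+ (if i == 0%N :> nat then k else e i)) =
    \sum_j x j ^+ k * c j.
Proof.
move=> m_gt0; pose i0 := Ordinal m_gt0.
pose M k := \matrix_(i, j) x j ^+ (if i == 0%N :> nat then k else e i).
exists (cofactor (M 0%N) i0) => k; rewrite (expand_det_row _ i0).
apply: eq_bigr => j _; rewrite mxE; congr (_ * (_ * \det _)).
apply/matrixP => i l; rewrite !mxE.
by have : lift i0 i != 0%N :> nat by []; case: eqP.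
Qed.

Section Alternants.
Variables (A : idomainType) (m : nat).
Local Notation alternant := (@alternant A m).

Lemma msymXU n (s : 'S_n) (v : 'I_n) : msym s ('X_v : {mpoly A[n]}) = 'X_(s v).
Proof. by rewrite /msym mmapX mmap1U. Qed.

Lemma alternant_perm (s : 'S_m) e :
  alternant (e \o s) = (-1) ^+ s * alternant e.
Proof.
rewrite /alternant -det_perm -det_mulmx -row_permE; congr (\det _).
by apply/matrixP => i j; rewrite !mxE.
Qed.

Lemma antisymmetrize_monomial (a : 'X_{1..m}) :
  \sum_(s : 'S_m) (-1) ^+ s * msym s 'X_[a] = alternant a.
Proof.
apply: eq_bigr => s _; congr (_ * _); rewrite mpolyXE_id rmorph_prod.
by apply: eq_bigr => i _; rewrite rmorphXn /= msymXU mxE.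
Qed.

Definition decreasing (e : 'I_m -> nat) : Prop :=
  forall i j : 'I_m, (i < j)%N -> (e j < e i)%N.

Lemma alternantE e : alternant e =
  \sum_(s : 'S_m) (-1) ^+ s * 'X_[[multinom e ((s^-1)%g i) | i < m]].
Proof.
apply: eq_bigr => s _; congr (_ * _).
rewrite mpolyXE_id [RHS](reindex_inj (@perm_inj _ s)).
by apply: eq_bigr => i _; rewrite mxE mnmE permK.
Qed.

Lemma mcoeff_alternant_lt e (a : 'X_{1..m}) N :
  (forall i, e i < N)%N -> (alternant e)@_a != 0 -> forall i, (a i < N)%N.
Proof.
move=> eN; apply: contra_neqP => ana; rewrite alternantE raddf_sum big1 //= => s _.
rewrite mulr_sign; case: (odd_perm s); rewrite ?mcoeffN mcoeffX; case: eqP; rewrite ?oppr0 //.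
all: by move=> aE; case: ana => i; rewrite -aE mnmE.
Qed.

(** Two strictly decreasing exponents can only be matched by the identity permutation, so an
    alternant contains a single decreasing monomial. *)
Lemma mcoeff_alternant e (a : 'X_{1..m}) : decreasing e -> decreasing a ->
  (alternant e)@_a = ([multinom e i | i < m] == a)%:R.
Proof.
move=> de da.
rewrite alternantE raddf_sum (bigD1 1%g) //= big1 ?addr0 => [|s s1].
  rewrite odd_perm1 mul1r mcoeffX; congr (_ == _)%:R.
  by apply/mnmP => i; rewrite !mnmE invg1 perm1.
rewrite mulr_sign; case: (odd_perm s); rewrite ?mcoeffN mcoeffX; case: eqP; rewrite ?oppr0 //.
all: move=> /mnmP h; case/negP: s1; apply/eqP/increasing_perm_id => i j /de.
all: have := h (s i); have := h (s j); rewrite !mnmE !permK => -> ->.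
all: rewrite ltnNge leq_eqVlt negb_or => /andP[ne nlt]; rewrite ltnNge; apply/negP.
all: by rewrite leq_eqVlt => /predU1P [e'|/da]; [rewrite -(val_inj e') eqxx in ne|apply/negP].
Qed.

Definition box_exponent n (l : box_partition m n) (i : 'I_m) : nat :=
  (tnth (box_parts l) i + delta i)%N.

Lemma box_partsE n (l : box_partition m n) i :
  tnth (box_parts l) i = tnth (val l) i.
Proof. by rewrite tnth_map. Qed.

Lemma box_exponent_decreasing n (l : box_partition m n) :
  decreasing (box_exponent l).
Proof.
move=> i j ij; rewrite /box_exponent !(tnth_nth 0%N) /delta.
have pl : is_partition (box_parts l) by exact: (valP l).
have : (nth 0 (box_parts l) j <= nth 0 (box_parts l) i)%N.
  have tr : transitive geq by move=> y x z /= h1 h2; exact: leq_trans h2 h1.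
  apply: (sorted_leq_nth tr leqnn 0%N pl); rewrite ?inE ?size_tuple //; exact: ltnW.
by have := ltn_ord j; lia.
Qed.

Lemma box_exponent_lt n (l : box_partition m n) i : (box_exponent l i < m + n)%N.
Proof.
rewrite /box_exponent box_partsE /delta.
by have := ltn_ord (tnth (val l) i); have := ltn_ord i; lia.
Qed.

Lemma box_exponent_inj n (l l' : box_partition m n) :
  box_exponent l =1 box_exponent l' -> l = l'.
Proof.
move=> h; apply/val_inj/eq_from_tnth => i; apply/val_inj.
by have /addIn := h i; rewrite !box_partsE.
Qed.

(** The strictly decreasing sequences of length m with values below m + n are the lambda + delta
    with lambda in the m by n box. A repeated exponent gives zero; otherwise sorting costs a
    sign. *)
Lemma alternant_box n e : (forall i, e i < m + n)%N ->
  exists (c : A) (l : box_partition m n), alternant e = c *: alternant (box_exponent l).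
Proof.
move=> en; have [inj|ninj] := pselect (injective e); last first.
  have p0 : is_partition (map val [tuple (ord0 : 'I_n.+1) | _ < m]).
    apply/(sortedP 0%N) => i; rewrite size_map size_tuple => im.
    have h j : (j < m)%N -> nth 0 (map val [tuple (ord0 : 'I_n.+1) | _ < m]) j = 0%N.
      move=> jm; rewrite (nth_map ord0) ?size_tuple //.
      by rewrite -[j]/(val (Ordinal jm)) -tnth_nth tnth_mktuple.
    by rewrite !h // ltnW.
  (* The coefficient is zero, but a box partition must still be named: the empty one. *)
  exists 0, (exist _ [tuple (ord0 : 'I_n.+1) | _ < m] p0); rewrite scale0r.
  have /existsNP[i /existsNP[j /not_implyP[eij ij]]] := ninj.
  rewrite /Defs.alternant (@determinant_alternate _ _ _ i j) //; first exact/eqP.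
  by move=> k; rewrite !mxE eij.
pose t := [tuple e i | i < m]; pose st := [tuple of sort geq t].
have /tuple_permP [p pE] : perm_eq st t by rewrite /= perm_sort.
have stE i : tnth st i = e (p i).
  have -> : st = [tuple tnth t (p i) | i < m] by exact: val_inj.
  by rewrite !tnth_mktuple.
pose f i := e (p i).
have st_sorted : sorted geq st by apply: sort_sorted => x y /=; exact: leq_total.
have fdec : decreasing f.
  move=> i j ij; rewrite ltn_neqAle; apply/andP; split.
    apply/negP => /eqP /inj /perm_inj ji; by rewrite ji ltnn in ij.
  rewrite /f -!stE !(tnth_nth 0%N).
  have tr : transitive geq by move=> y x z /= h1 h2; exact: leq_trans h2 h1.
  apply: (sorted_leq_nth tr leqnn 0%N st_sorted); rewrite ?inE ?size_tuple //; exact: ltnW.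
have fgap := decreasing_gap fdec.
(* The lower bound makes [f i - delta i] a true difference, the upper bound makes it at most [n]. *)
have fb (i : 'I_m) : (m - i.+1 <= f i < m + n - i)%N.
  have m_gt0 : (0 < m)%N by exact: leq_ltn_trans (ltn_ord i).
  have m1 : (m.-1 < m)%N by lia.
  have := fgap i (Ordinal m1); have := fgap (Ordinal m_gt0) i; have := en (p (Ordinal m_gt0)).
  by have := ltn_ord i; rewrite /= -/(f (Ordinal m_gt0)); lia.
pose l := [tuple (inord (f i - delta i) : 'I_n.+1) | i < m].
have lE i : val (tnth l i) = (f i - delta i)%N.
  by rewrite tnth_mktuple /= inordK // /delta; have := fb i; have := ltn_ord i; lia.
have pl : is_partition (map val l).
  apply/(sortedP 0%N) => i; rewrite size_map size_tuple => im.
  have h j (jm : (j < m)%N) : nth 0 (map val l) j = (f (Ordinal jm) - delta (Ordinal jm))%N.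
    by rewrite -lE (nth_map ord0) ?size_tuple // (tnth_nth ord0).
  rewrite (h _ im) (h _ (ltnW im)) /delta /=.
  by have := fdec (Ordinal (ltnW im)) (Ordinal im) (leqnn _); lia.
pose b : box_partition m n := exist _ l pl.
exists ((-1) ^+ p), b.
have -> : alternant (box_exponent b) = alternant (e \o p).
  congr (\det _); apply/matrixP => i j; rewrite !mxE; congr (_ ^+ _).
  by rewrite /box_exponent box_partsE /= lE subnK //; have /andP[] := fb i.
rewrite alternant_perm -mul_mpolyC rmorphXn rmorphN1 mulrA -expr2 sqrr_sign mul1r //.
Qed.

End Alternants.

(** * Rim-hooks *)

Lemma partition_nth_anti (l : seq nat) a b :
  is_partition l -> (a <= b)%N -> (nth 0 l b <= nth 0 l a)%N.
Proof.
move=> pl ab; have [lb|lb] := ltnP b (size l); last by rewrite (nth_default _ lb).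
have tr : transitive geq by move=> y x z /= h1 h2; exact: leq_trans h2 h1.
have la : (a < size l)%N by exact: leq_ltn_trans lb.
exact: (sorted_leq_nth tr leqnn 0%N pl a b la lb ab).
Qed.

(** The positive integers up to [n] that satisfy a downward closed predicate form an initial
    interval, whose length is the count. *)
Lemma count_iota_downset (P : pred nat) n k :
  (forall k, (0 < k)%N -> P k.+1 -> P k) -> (0 < k <= n)%N ->
  P k = (k <= count P (iota 1 n))%N.
Proof.
move=> down; have downN j i : (0 < j)%N -> P (j + i)%N -> P j.
  by elim: i j => [|i ih] j j0; rewrite ?addn0 // addnS => /down; rewrite addn_gt0 j0 => /(_ isT) /(ih _ j0).
elim: n k => [|n ih] k; first by lia.
have -> : iota 1 n.+1 = iota 1 n ++ [:: n.+1] by rewrite -[n.+1]addn1 iotaD addn1.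
rewrite count_cat /= addn0 => /andP[k0 kn].
have cn : (count P (iota 1 n) <= n)%N by rewrite -[leqRHS](size_iota 1) count_size.
have [kn'|kn'] := leqP k n; last first.
  have -> : k = n.+1 by lia.
  case: (boolP (P n.+1)) => Pn /=; last by lia.
  case: (posnP n) => [->//|n0].
  by have := ih n; rewrite (downN n 1%N n0) ?addn1 // n0 leqnn => /(_ isT); lia.
rewrite ih ?k0 //; case: (boolP (P n.+1)) => Pn /=; last by rewrite addn0.
have : (k <= count P (iota 1 n))%N.
  by rewrite -ih ?k0 // (downN k (n.+1 - k)%N) // subnKC //; lia.
lia.
Qed.

(** A walk with unit steps that may neither repeat a value nor visit [c.+1] can only descend. It
    will be applied to the contents along a rim-hook. *)
Lemma descending_walk c cs :
  path (fun x y => (x.+1 == y) || (y.+1 == x)) c cs -> uniq (c :: cs) ->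
  c.+1 \notin cs ->
  (size cs <= c)%N /\ forall x, (x \in c :: cs) = (c - size cs <= x <= c)%N.
Proof.
elim: cs c => [|d cs ih] c /=.
  by move=> _ _ _; split=> // x; rewrite inE; lia.
case/andP=> step pth /andP[c_cs d_cs]; rewrite inE negb_or => /andP[cd c'cs].
have {step}cE : c = d.+1 by move: step; rewrite (negbTE cd) => /eqP.
have := ih d pth d_cs; rewrite -cE; move: c_cs; rewrite inE negb_or => /andP[_ c_cs].
move=> /(_ c_cs) [sz mem]; split; first by lia.
by move=> x; rewrite inE mem; lia.
Qed.

Section RimHooks.
Variables (m : nat) (l : m.+1.-tuple nat) (n : nat).
Hypothesis l_part : is_partition l.

(* The content of a box is shifted by the number of rows, so that the last box of
   row a has content beta a - 1. *)
Definition content (b : nat * nat) : nat := (b.2 + (m - b.1))%N.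
Definition beta (a : nat) : nat := (nth 0 l a + (m - a))%N.

(** The row of the rim box of content [c]: [beta] is strictly decreasing, so the rows with
    [c < beta k] come first. Row 0 is not counted, which numbers the rows from 0; every content on
    the rim is below [beta 0]. *)
Definition hook_row (c : nat) : nat := count (fun k => c < beta k)%N (iota 1 m).
Definition hook_box (c : nat) : nat * nat := (hook_row c, c - (m - hook_row c))%N.

Lemma hook_rowP c k : (0 < k <= m)%N -> (c < beta k)%N = (k <= hook_row c)%N.
Proof.
apply: (count_iota_downset (P := fun k => c < beta k)%N) => j j0 lt.
apply: leq_trans lt _; rewrite /beta.
by have := partition_nth_anti l_part (leqnSn j); lia.
Qed.

Lemma hook_row_le c : (hook_row c <= m)%N.
Proof. by rewrite -[leqRHS](size_iota 1) count_size. Qed.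

Lemma in_diagram_row b : in_diagram l b -> (b.1 <= m)%N.
Proof.
rewrite /in_diagram; have [//|mb] := leqP b.1 m.
by rewrite [nth _ _ _]nth_default ?size_tuple.
Qed.

(** For a rim box, [beta b.1.+1 <= content b < beta b.1] when both rows exist, and this pins the row
    down. *)
Lemma rim_row b : on_rim l b -> hook_row (content b) = b.1.
Proof.
case/andP=> bl; have bm := in_diagram_row bl; move: bl.
rewrite /in_diagram -leqNgt /= => bl bl'.
have h k : (0 < k <= m)%N -> (k <= hook_row (content b))%N = (k <= b.1)%N.
  move=> km; rewrite -hook_rowP // /beta /content; have [kb|kb] := leqP k b.1.
    by have := partition_nth_anti l_part kb; lia.
  by have := partition_nth_anti l_part kb; lia.
have hm := hook_row_le (content b).
apply/eqP; rewrite eqn_leq; apply/andP; split.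
  by case: (posnP (hook_row (content b))) => [->//|r0]; rewrite -h ?r0.
by case: (posnP b.1) => [->//|r0]; rewrite h ?r0.
Qed.

Lemma rim_content_inj b b' :
  on_rim l b -> on_rim l b' -> content b = content b' -> b = b'.
Proof.
move=> rb rb' e; have := rim_row rb; rewrite e rim_row // => e1.
move: e; rewrite /content e1 => /addIn e2.
by rewrite [b]surjective_pairing [b']surjective_pairing e1 e2.
Qed.

Lemma rim_content_lt b : on_rim l b -> (content b < beta 0)%N.
Proof.
case/andP=> bl _; have bm := in_diagram_row bl; move: bl.
rewrite /in_diagram /content /beta.
by have := partition_nth_anti l_part (leq0n b.1); lia.
Qed.

Lemma adjacent_content b b' : (b.1 <= m)%N -> (b'.1 <= m)%N -> adjacent b b' ->
  ((content b).+1 == content b') || ((content b').+1 == content b).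
Proof. by rewrite /adjacent /content; case: b b' => [x y] [x' y'] /=; lia. Qed.

Hypothesis n_bounds : (0 < n <= beta 0)%N.
(** The content of the last of the [n] boxes of the hook, which starts at content [beta 0 - 1]; also
    the exponent that replaces [beta 0] in the alternant. *)
Local Notation cut := (beta 0 - n)%N.
Local Notation H := (hook_row cut).

(** In terms of exponents, [beta 0] is deleted, the values [beta 1], ..., [beta H] move up one row,
    and [cut] is inserted in row [H]. *)
Definition hook_part (a : nat) : nat :=
  if (a < H)%N then (nth 0%N l a.+1).-1
  else if a == H then (cut - (m - H))%N else nth 0%N l a.

Definition is_rim_top (p : seq (nat * nat)) :=
  forall b, (b \in p) = on_rim l b && (cut <= content b)%N.

(** Adjacent boxes have contents differing by one, and rim boxes are determined by their contents,
    so [descending_walk] leaves no choice for the hook. The second conclusion says that the box of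
    content [cut] in row [H] has a true column. *)
Lemma rim_hook_top p : is_rim_hook l n p ->
  is_rim_top p /\ (m - H <= cut)%N.
Proof.
case: p => // b p /and5P[/eqP sz /eqP bE pth up /allP rim].
have rb : on_rim l b by exact: rim (mem_head _ _).
have cb : content b = (beta 0).-1.
  move: rb; rewrite bE => /andP[+ _]; rewrite /in_diagram /content /beta /=; lia.
have [] := @descending_walk (content b) (map content p).
- rewrite path_map; move: rim pth; elim: p b {sz bE up rb cb} => //= d p ih b rim /andP[bd pth].
  apply/andP; split.
    apply: adjacent_content => //; apply: in_diagram_row.
      by case/andP: (rim b (mem_head _ _)).
    by have /andP[] : on_rim l d by apply: rim; rewrite !inE eqxx orbT.
  by apply: ih pth => x xp; apply: rim; rewrite inE xp orbT.
- rewrite -map_cons map_inj_in_uniq // => x y xp yp; apply: rim_content_inj; exact: rim.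
- apply/negP => /mapP [d dp e].
  have := rim_content_lt (rim d _); rewrite inE dp orbT => /(_ isT).
  by rewrite -e cb; lia.
rewrite size_map -map_cons => szc mem.
have {}mem x : (x \in map content (b :: p)) = (cut <= x < beta 0)%N.
  by rewrite mem cb -sz /=; move: n_bounds; rewrite -sz /=; lia.
have memp : is_rim_top (b :: p).
  move=> d; apply/idP/andP => [dp|[rd dc]].
    have rd := rim _ dp; split=> //.
    by have := map_f content dp; rewrite mem => /andP[].
  have : content d \in map content (b :: p) by rewrite mem dc rim_content_lt.
  by case/mapP => d' d'p /(rim_content_inj rd) -> //; exact: rim.
split=> //; have : cut \in map content (b :: p) by rewrite mem; lia.
by case/mapP => d /rim rd ->; rewrite (rim_row rd) /content leq_addl.
Qed.

Section Cut.
Hypothesis cut_ge : (m - H <= cut)%N.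

Lemma beta_H : (cut < beta H)%N.
Proof.
by case: (posnP H) => [->|h0]; [lia|rewrite hook_rowP ?h0 ?hook_row_le].
Qed.

Lemma beta_after_H a : (H < a)%N -> (a <= m)%N -> (beta a <= cut)%N.
Proof. by move=> ha am; rewrite leqNgt hook_rowP; lia. Qed.

Lemma part_H : (0 < nth 0 l H)%N.
Proof. by have := beta_H; rewrite [beta H]/beta; lia. Qed.

(** Above row [H] all rim boxes have content at least [cut]; in row [H] all boxes of content at
    least [cut] are on the rim; below, all contents are smaller than [cut]. *)
Lemma hook_part_diagram p a b : is_rim_top p -> (a <= m)%N ->
  (b < hook_part a)%N = in_diagram l (a, b) && ((a, b) \notin p).
Proof.
move=> -> am; rewrite /on_rim /hook_part.
have hm := hook_row_le cut; have lH := part_H.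
have bH : (cut < nth 0 l H + (m - H))%N by exact: beta_H.
case: (boolP (in_diagram l (a, b))) => [bl|bl] /=; last first.
  apply/negbTE; move: bl; rewrite /in_diagram /= -!leqNgt.
  have := partition_nth_anti l_part (leqnSn a).
  by case: (ltngtP a H) => [||->] /=; lia.
move: bl; rewrite /in_diagram /content /=; case: (ltngtP a H) => [aH|aH|->] /= bl.
- have := @hook_rowP cut a.+1; rewrite aH (leq_trans aH hm) [beta a.+1]/beta => /(_ isT).
  by have := partition_nth_anti l_part aH; lia.
- by have := beta_after_H aH am; rewrite [beta a]/beta; lia.
- have [hm'|hm'] := ltnP H m.
    by have := beta_after_H (ltnSn H) hm'; rewrite [beta H.+1]/beta; lia.
  by rewrite [nth 0%N l H.+1]nth_default ?size_tuple //; lia.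
Qed.

Lemma hook_height p : is_rim_top p -> size (undup (map fst p)) = H.+1.
Proof.
move=> hp; rewrite -[RHS](size_iota 0); apply/perm_size/uniq_perm.
- exact: undup_uniq.
- exact: iota_uniq.
move=> a; rewrite mem_undup mem_iota /= add0n ltnS.
apply/mapP/idP => [[b]|aH].
  rewrite hp => /andP[rb cb] ->; rewrite -(rim_row rb).
  case: (posnP (hook_row (content b))) => [->//|h0].
  by rewrite -hook_rowP ?h0 ?hook_row_le // (leq_ltn_trans cb) // hook_rowP ?h0 ?hook_row_le.
have am : (a <= m)%N by exact: leq_trans aH (hook_row_le _).
have lH := part_H; have la := partition_nth_anti l_part aH.
exists (a, (nth 0%N l a).-1) => //; rewrite hp /on_rim /in_diagram /content /=.
have := partition_nth_anti l_part (leqnSn a).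
have : (cut < beta a)%N.
  by case: (posnP a) => [->|a0]; [lia|rewrite hook_rowP ?a0].
rewrite [beta a]/beta; lia.
Qed.

Lemma hook_boxP c : (cut <= c < beta 0)%N ->
  on_rim l (hook_box c) /\ content (hook_box c) = c.
Proof.
move=> hc; have hm := hook_row_le c.
have rH : (hook_row c <= H)%N.
  case: (posnP (hook_row c)) => [->//|h0].
  rewrite -hook_rowP ?h0 //; apply: leq_ltn_trans (_ : cut <= c)%N _; first by lia.
  by rewrite hook_rowP ?h0.
have lc : (c < beta (hook_row c))%N.
  case: (posnP (hook_row c)) => [->|h0]; [lia|by rewrite hook_rowP ?h0].
(* This keeps the subtraction defining the column of [hook_box c] from truncating. *)
have cm : (m - hook_row c <= c)%N.
  have [e|ne] := eqVneq (hook_row c) H; first by rewrite e; lia.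
  have := @hook_rowP c (hook_row c).+1; rewrite ltnn => h.
  have := partition_nth_anti l_part (_ : (hook_row c).+1 <= H)%N; have := part_H.
  have := hook_row_le cut; move: h; rewrite [beta _.+1]/beta; lia.
split; last by rewrite /content /=; lia.
rewrite /on_rim /in_diagram /=; move: lc; rewrite [beta (hook_row c)]/beta => lc.
apply/andP; split; first by lia.
have [hm'|hm'] := ltnP (hook_row c) m; last by rewrite nth_default ?size_tuple.
by have := @hook_rowP c (hook_row c).+1; rewrite ltnn hm' [beta _.+1]/beta; lia.
Qed.

Definition hook : seq (nat * nat) := [seq hook_box ((beta 0).-1 - i)%N | i <- iota 0 n].

(** Distinct rows have distinct [beta], so lowering the content by one passes at most one row: the
    hook goes one box left or one box down. *)
Lemma hook_row_step c : (cut <= c)%N -> (c.+1 < beta 0)%N ->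
  (hook_row c.+1 <= hook_row c <= (hook_row c.+1).+1)%N.
Proof.
move=> hc hc'; apply/andP; split.
  case: (posnP (hook_row c.+1)) => [->//|h0].
  by rewrite -hook_rowP ?h0 ?hook_row_le // ltnW // hook_rowP ?h0 ?hook_row_le.
rewrite leqNgt; apply/negP => h.
have h1 := hook_row_le c; have h2 := hook_row_le c.+1.
have := @hook_rowP c (hook_row c.+1).+2; rewrite h.
have := @hook_rowP c.+1 (hook_row c.+1).+1; rewrite ltnn.
have := partition_nth_anti l_part (leqnSn (hook_row c.+1).+1).
rewrite [beta _.+1]/beta [beta _.+2]/beta; lia.
Qed.

Lemma hook_is_rim_hook : is_rim_hook l n hook.
Proof.
have : size hook = n by rewrite size_map size_iota.
have inI i : i \in iota 0 n -> (cut <= (beta 0).-1 - i < beta 0)%N.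
  by rewrite mem_iota; lia.
have uh : uniq hook.
  rewrite map_inj_in_uniq ?iota_uniq // => i j ii jj /(congr1 content).
  have [_ ->] := hook_boxP (inI i ii); have [_ ->] := hook_boxP (inI j jj).
  by move: ii jj; rewrite !mem_iota; lia.
have rh : all (on_rim l) hook.
  by apply/allP => b /mapP [i ii ->]; have [] := hook_boxP (inI i ii).
have step i : (i.+1 < n)%N ->
    adjacent (hook_box ((beta 0).-1 - i)) (hook_box ((beta 0).-1 - i.+1)).
  move=> hi; have ii : i \in iota 0 n by rewrite mem_iota; lia.
  have ii' : i.+1 \in iota 0 n by rewrite mem_iota; lia.
  have [_] := hook_boxP (inI _ ii); have [_] := hook_boxP (inI _ ii').
  have := @hook_row_step ((beta 0).-1 - i.+1).
  have -> : ((beta 0).-1 - i.+1).+1 = ((beta 0).-1 - i)%N by lia.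
  have := hook_row_le ((beta 0).-1 - i); have := hook_row_le ((beta 0).-1 - i.+1).
  rewrite /content /adjacent /=; case: eqVneq => [->|ne] h1 h2 h3 h4 h5.
    by apply/orP; left; rewrite /=; apply/orP; right; lia.
  by apply/orP; right; apply/andP; split; [lia|apply/orP; left; lia].
have hd : hook_box ((beta 0).-1 - 0) = (0, (nth 0 l 0).-1)%N.
  have row0 : hook_row ((beta 0).-1 - 0) = 0%N.
    have hm := hook_row_le ((beta 0).-1 - 0); case: (posnP m) => [m0|m0]; first by lia.
    have := @hook_rowP ((beta 0).-1 - 0) 1 m0.
    have := partition_nth_anti l_part (leqnSn 0).
    by rewrite [beta 1]/beta [beta 0]/beta; lia.
  by rewrite /hook_box row0 /beta; congr (_, _); lia.
move: uh rh; rewrite /is_rim_hook /hook.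
case: n n_bounds step => [//|k] _ step uh rh sz.
move: uh rh sz; rewrite /= hd => -> -> ->; rewrite !eqxx andbT /= andbT.
have down j i : (j + i = k)%N -> path adjacent (hook_box ((beta 0).-1 - j))
    [seq hook_box ((beta 0).-1 - i)%N | i <- iota j.+1 i].
  elim: i j => //= i ih j jk; rewrite step /=; last by lia.
  by apply: ih; rewrite addSnnS.
by rewrite -hd down.
Qed.

End Cut.

Lemma removal_shape (l' : m.+1.-tuple nat) h : rim_hook_removal l n l' h ->
  h = H.+1 /\ forall a, (a <= m)%N -> nth 0 l' a = hook_part a.
Proof.
case=> p [/rim_hook_top [hp hc] _ diag ->]; split; first exact: hook_height.
move=> a am; apply/eqP; rewrite eq_sym eqn_leq; apply/andP; split; rewrite leqNgt; apply/negP.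
  by rewrite (hook_part_diagram _ _ hp) // -diag /in_diagram ltnn.
by have := diag (a, hook_part a); rewrite -(hook_part_diagram _ _ hp) // ltnn /in_diagram => ->.
Qed.

(** Without a collision [beta H.+1 < cut] is strict when row [H.+1] exists, which is what makes the
    shortened row [H] at least as long as the next one. *)
Lemma removal_exists : (forall a, (0 < a <= m)%N -> beta a != cut) ->
  exists x : m.+1.-tuple nat * nat, rim_hook_removal l n x.1 x.2.
Proof.
move=> ne; have hm := hook_row_le cut.
have hlt : (H < m)%N -> (beta H.+1 < cut)%N.
  move=> h; have := @hook_rowP cut H.+1; rewrite ltnn h => /(_ isT).
  by have := ne H.+1 h; lia.
have hc : (m - H <= cut)%N.
  have [/hlt|] := ltnP H m; last by lia.
  by rewrite [beta H.+1]/beta; lia.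
have hook_top := (rim_hook_top (hook_is_rim_hook hc)).1.
pose l' := [tuple hook_part a | a < m.+1].
have nth_l' a : (a <= m)%N -> nth 0 l' a = hook_part a.
  by rewrite -ltnS => am; rewrite -[a]/(val (Ordinal am)) -tnth_nth tnth_mktuple.
exists (l', size (undup (map fst (hook)))); exists hook; split=> //.
- exact: hook_is_rim_hook.
- apply/(sortedP 0%N) => a; rewrite size_tuple ltnS => am /=.
  rewrite (nth_l' _ am) (nth_l' _ (ltnW am)) /hook_part.
  have := partition_nth_anti l_part (leqnSn a); have := partition_nth_anti l_part (leqnSn a.+1).
  have := beta_H hc; rewrite [beta H]/beta.
  case: (ltngtP a H) => [aH|aH|aH] /=; case: (ltngtP a.+1 H) => [aH'|aH'|aH'] /=; try lia.
    by rewrite aH'; lia.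
  by move: hlt; rewrite -aH [beta a.+1]/beta => /(_ am); lia.
case=> a b; have [am|am] := leqP a m.
  by rewrite -(hook_part_diagram _ _ hook_top) // /in_diagram /= -nth_l'.
have -> : in_diagram l (a, b) = false by rewrite /in_diagram [nth _ _ _]nth_default ?size_tuple.
by rewrite /in_diagram [nth _ _ _]nth_default ?size_tuple.
Qed.

(** Sorting the lowered exponent from row 0 into row [H] is a cycle of sign (-1)^H, and the height
    [H.+1] gives [RH] the same sign. *)
Lemma RH_alternant (A : idomainType) :
  RH (fun l : m.+1.-tuple nat => alternant A (fun i => tnth l i + delta i)%N) n l =
  alternant A (fun i => if i == ord0 then cut else tnth l i + delta i)%N.
Proof.
have betaE (i : 'I_m.+1) : (tnth l i + delta i)%N = beta i.
  by rewrite (tnth_nth 0%N) /delta subSS.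
rewrite /RH; case: pselect => [ex|nex].
  have [hE l'E] := removal_shape (projT2 (cid ex)).
  rewrite [X in _ ^+ X]/= in hE *; set x := projT1 (cid ex) in hE l'E *.
  have Hm : (H < m.+1)%N by rewrite ltnS hook_row_le.
  (* The cycle that sends row [H] to row 0 and keeps the order of the remaining rows. *)
  pose s := lift_perm (Ordinal Hm) ord0 1%g.
  rewrite hE 2!exprS mulN1r mulN1r opprK.
  have hc : (m - H <= cut)%N by have [p [/rim_hook_top[]]] := projT2 (cid ex).
  have expE (i : 'I_m.+1) : (tnth x.1 i + delta i)%N =
      if s i == ord0 then cut else (tnth l (s i) + delta (s i))%N.
    have im : (i <= m)%N by rewrite -ltnS.
    rewrite betaE (tnth_nth 0%N) (l'E _ im) /delta subSS.
    have lH := part_H hc; case: (unliftP (Ordinal Hm) i) => [k|] ->.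
      rewrite lift_perm_lift perm1 /hook_part [beta (lift _ _)]/beta /= /bump /=.
      have := ltn_ord k; case: (leqP H k) => /= Hk km; rewrite ?add0n add1n.
        by rewrite ltnNge (leqW Hk) gtn_eqF.
      by have := partition_nth_anti l_part Hk; rewrite Hk; lia.
    by rewrite lift_perm_id eqxx /hook_part /= ltnn eqxx; lia.
  have -> : alternant A (fun i => tnth x.1 i + delta i)%N =
      (-1) ^+ s * alternant A (fun i => if i == ord0 then cut else tnth l i + delta i)%N.
    rewrite /alternant -det_perm -det_mulmx -row_permE; congr (\det _).
    by apply/matrixP => i j; rewrite !mxE expE.
  by rewrite mulrA odd_lift_perm odd_perm1 addbF /= addbF signr_odd -expr2 sqrr_sign mul1r.
(* With no removal available, another row has exponent [cut] too, so the determinant has two equal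
   rows. *)
have [a /andP[am /eqP e]] : exists a, (0 < a <= m)%N && (beta a == cut).
  apply: contrapT => nex'; apply: nex; apply: removal_exists => a am.
  by apply/negP => e; apply: nex'; exists a; rewrite am.
have am' : (a < m.+1)%N by lia.
rewrite /alternant (@determinant_alternate _ _ _ ord0 (Ordinal am')) //.
  by apply/eqP => /(congr1 val) /=; lia.
move=> j; rewrite !mxE eqxx betaE /= e ifN //; apply/eqP => /(congr1 val) /=; lia.
Qed.
End RimHooks.

(** [RH] involves only zero and signs, so it also commutes with maps that are not multiplicative,
    such as multiplication by an alternant. *)
Lemma RH_natural (V V' : pzRingType) (f : V -> V') m (s : m.-tuple nat -> V) n l :
  f 0 = 0 -> (forall x, f (- x) = - f x) ->
  RH (fun l => f (s l)) n l = f (RH s n l).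
Proof.
move=> f0 fN; rewrite /RH; case: pselect => // ex.
by rewrite -[X in X * _]signr_odd -[X in f (X * _)]signr_odd !mulr_sign; case: odd.
Qed.

(** The form needed for [r (vtx i)] variables, a number that is positive but not written as a
    successor. *)
Lemma RH_alternant_pos (A : idomainType) m (l : m.-tuple nat) n :
  (0 < m)%N -> is_partition l -> (0 < n <= nth 0 l 0 + m.-1)%N ->
  RH (fun l : m.-tuple nat => alternant A (fun i => tnth l i + delta i)%N) n l =
  alternant A (fun i : 'I_m =>
    if i == 0%N :> nat then (nth 0 l 0 + m.-1 - n)%N else (tnth l i + delta i)%N).
Proof.
case: m l => // m l _ l_part; rewrite -[m.+1.-1]subn0 => n_bounds.
exact: RH_alternant.
Qed.

(** * The presentation of quantum cohomology *)

Lemma extend_perm k n (f : 'I_k -> 'I_n) (t : 'S_k) : injective f ->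
  exists s : 'S_n, (forall j, s (f j) = f (t j)) /\
    forall v, (forall j, v != f j) -> s v = v.
Proof.
move=> finj; pose g v := if [pick j | f j == v] is Some j then f (t j) else v.
have gf j : g (f j) = f (t j).
  by rewrite /g; case: pickP => [j' /eqP /finj ->|/(_ j)]; rewrite ?eqxx.
have gN v : (forall j, v != f j) -> g v = v.
  by move=> h; rewrite /g; case: pickP => // j /eqP e; have := h j; rewrite e eqxx.
have dec v : (exists j, v = f j) \/ forall j, v != f j.
  have [|h] := pselect (exists j, v = f j); first by left.
  by right=> j; apply/negP => /eqP e; apply: h; exists j.
have ginj : injective g.
  move=> u v; have [[j ->]|hu] := dec u; have [[j' ->]|hv] := dec v.
  - by rewrite !gf => /finj /perm_inj ->.
  - by rewrite gf (gN _ hv) => e; have := hv (t j); rewrite e eqxx.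
  - by rewrite gf (gN _ hu) => e; have := hu (t j'); rewrite e eqxx.
  by rewrite !gN.
by exists (perm ginj); split=> [j|v /gN]; rewrite permE.
Qed.

(** The sign is left unspecified because it does not affect ideal membership. *)
Lemma signed_vandermonde (A : idomainType) m : exists b : nat,
  \prod_(j < m) \prod_(k < m | (j < k)%N) ('X_j - 'X_k : {mpoly A[m]}) =
  (-1) ^+ b * alternant A (@delta m).
Proof.
have [b ->] := alternant_delta A m.
have -> : vander A m = \prod_(j < m) \prod_(k < m | (j < k)%N) ('X_k - 'X_j).
  rewrite (_ : vander A m = \det (Vandermonde m (\row_j ('X_j : {mpoly A[m]})))); last first.
    by congr (\det _); apply/matrixP => i j; rewrite !mxE.
  by rewrite det_Vandermonde; apply: eq_bigr => i _; apply: eq_bigr => j _; rewrite !mxE.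
set V := \prod_(j < m) \prod_(k < m | (j < k)%N) ('X_k - 'X_j : {mpoly A[m]}).
have [c ->] : exists c : nat,
    \prod_(j < m) \prod_(k < m | (j < k)%N) ('X_j - 'X_k) = (-1) ^+ c * V.
  rewrite /V; elim/big_rec2: _ => [|j x y _ [c ->]]; first by exists 0%N; rewrite mulr1.
  exists (#|[pred k : 'I_m | (j < k)%N]| + c)%N.
  rewrite exprD mulrACA; congr (_ * _); rewrite -prodrN.
  by apply: eq_bigr => k _; rewrite opprB.
by exists (c + b)%N; rewrite exprD -mulrA; congr (_ * _); rewrite mulrA -signr_addb addbb mul1r.
Qed.

Lemma mulr_natb_if (A : pzSemiRingType) (b : bool) (c x : A) :
  c * b%:R * x = c * (if b then x else 0).
Proof. by case: b; rewrite ?mulr1 // !mulr0 mul0r. Qed.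

Lemma mulr_expansion (A : comPzRingType) (I : finType) (a b p x : A) (f c : I -> A) :
  a * x = \sum_j f j * c j -> b = - p -> a * (b * x) = - \sum_j p * f j * c j.
Proof.
move=> axE ->; rewrite mulrCA axE mulNr mulr_sumr; congr (- _).
by apply: eq_bigr => j _; rewrite mulrA.
Qed.

Section Presentation.
Variables (R : realType) (Q : quiver) (r : vertex Q -> nat).
Local Notation n := #|root_index r|.
Local Notation Cq := (Cq R Q).
Local Notation Cxq := {mpoly Cq[n]}.
Local Notation root_var := (@root_var R Q r _).

Local Notation chern_roots := (@chern_roots R Q r).

Definition block (v : 'I_n) : 'I_(rho Q) := tag (enum_val v).

Lemma block_root_rank i (k : 'I_(r (vtx i))) : block (root_rank k) = i.
Proof. by rewrite /block enum_rankK. Qed.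

Lemma root_rank_tagged (v : 'I_n) : root_rank (tagged (enum_val v)) = v.
Proof. by rewrite -[RHS]enum_valK /root_rank; congr enum_rank; case: (enum_val v). Qed.

Lemma root_rankP (v : 'I_n) i : block v = i -> exists k : 'I_(r (vtx i)), v = root_rank k.
Proof. by move=> <-; exists (tagged (enum_val v)); rewrite root_rank_tagged. Qed.

Lemma root_rank_inj i : injective (@root_rank Q r i).
Proof. by move=> k l /enum_rank_inj /eqP; rewrite eq_Tagged => /eqP. Qed.

Definition qrel_at (v : 'I_n) : Cxq := qrel R (tagged (enum_val v)).

Lemma IabE f : Iab f <-> in_ideal qrel_at f.
Proof.
have reidx (c : root_index r -> Cxq) :
    \sum_(u : root_index r) c u * qrel R (tagged u) = \sum_v c (enum_val v) * qrel_at v.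
  by apply: (reindex (@enum_val (root_index r) (root_index r))); exact/onW_bij/enum_val_bij.
split=> [[c ->]|[c ->]]; first by exists (fun v => c (enum_val v)).
exists (fun u => c (enum_rank u)); rewrite reidx.
by apply: eq_bigr => v _; rewrite enum_valK.
Qed.

Lemma Iab_gen i (k : 'I_(r (vtx i))) g : Iab (g * qrel R k).
Proof.
apply/IabE; have -> : qrel R k = qrel_at (root_rank k).
  by rewrite /qrel_at enum_rankK.
exact: in_ideal_gen.
Qed.

Lemma IabD (f g : Cxq) : Iab f -> Iab g -> Iab (f + g).
Proof. by move=> hf hg; rewrite -[g]opprK; apply: IabB => //; rewrite -mulN1r; exact: IabM. Qed.

Lemma Iab_sum (I : Type) (l : seq I) (P : pred I) (F : I -> Cxq) :
  (forall i, P i -> Iab (F i)) -> Iab (\sum_(i <- l | P i) F i).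
Proof. by move=> h; apply: big_ind => //; [exact: Iab0|exact: IabD]. Qed.

(** * Polynomials in the Chern classes and the quantum parameters *)

Definition chern_value (P : {mpoly Cq[n]}) : CxqW R r :=
  mmap (in_alg (CxqW R r)) (fun v => chernW R (tagged (enum_val v))) P.

(** As a subring it passes through [polyOver] from the factors of [chern_poly] to its coefficients.
    It yields both their W-invariance and the polynomials of the rim-hook expansion. *)
Definition in_chern : {pred Cxq} :=
  fun f => `[< exists P, f = inv_val (chern_value P) >].

Lemma in_chern_subring : subring_closed in_chern.
Proof.
split.
- apply/asboolP; exists 1; by rewrite /chern_value rmorph1.
- move=> f g /asboolP [P ->] /asboolP [P' ->]; apply/asboolP; exists (P - P').
  by rewrite /chern_value rmorphB.
move=> f g /asboolP [P ->] /asboolP [P' ->]; apply/asboolP; exists (P * P').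
by rewrite /chern_value rmorphM.
Qed.
HB.instance Definition _ := GRing.isSubringClosed.Build Cxq in_chern in_chern_subring.

Lemma in_chern_invariant f : f \in in_chern -> f \in @W_invariant R Q r.
Proof. by case/asboolP => P ->; exact: (valP (chern_value P)). Qed.

Lemma in_chern_const (c : Cq) : c%:MP \in in_chern.
Proof.
apply/asboolP; exists c%:MP; rewrite /chern_value mmapC /=.
by rewrite -[RHS]/(c *: 1 : Cxq) -alg_mpolyC.
Qed.

Lemma in_chern_mesym i k : in_roots (mesym (r (vtx i)) Cq k) \in in_chern.
Proof.
case: k => [|k]; first by rewrite mesym0E /in_roots comp_mpoly1 rpred1.
have [kr|kr] := ltnP k (r (vtx i)); last first.
  by rewrite mesym_geqnE // /in_roots comp_mpoly0 rpred0.
apply/asboolP; exists 'X_(root_rank (Ordinal kr)).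
by rewrite /chern_value mmapX mmap1U enum_rankK.
Qed.

Lemma in_rootsXU i k : in_roots ('X_k : {mpoly Cq[r (vtx i)]}) = root_var k.
Proof. by rewrite /in_roots comp_mpolyXU -tnth_nth tnth_mktuple. Qed.

(** Vieta: the coefficients are, up to sign, elementary symmetric polynomials in the roots. *)
Lemma chern_roots_over v :
  \prod_(y <- chern_roots v) ('X - y%:P) \is a polyOver in_chern.
Proof.
rewrite /chern_roots; case: unliftP => [i _|_]; last first.
  by rewrite big_seq1 rpredB ?polyOverX // polyOverC rpred0.
pose cs := [tuple root_var k | k < r (vtx i)].
rewrite -[map _ _]/(val cs); apply/polyOverP => k.
have [rk|kr] := ltnP (r (vtx i)) k.
  by rewrite nth_default ?rpred0 // size_prod_XsubC size_tuple.
have k' : (r (vtx i) - k < (r (vtx i)).+1)%N by rewrite ltnS leq_subr.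
rewrite -(subKn kr) (mroots_coeff cs (Ordinal k')) /= rpredM ?rpredX ?rpredN1 //.
have -> : (mesym (r (vtx i)) Cxq (r (vtx i) - k)).@[tnth cs] =
    in_roots (mesym (r (vtx i)) Cq (r (vtx i) - k)).
  rewrite /in_roots [in LHS]/mesym raddf_sum; symmetry.
  rewrite [in LHS]/mesym raddf_sum; apply: eq_bigr => h _.
  rewrite [LHS]rmorph_prod [RHS]rmorph_prod; apply: eq_bigr => j _ /=.
  by rewrite mevalXU comp_mpolyXU -tnth_nth.
exact: in_chern_mesym.
Qed.

Local Notation root_rank := (@root_rank Q r _).

Definition roots_in (i : 'I_(rho Q)) : seq Cxq :=
  flatten [seq chern_roots (src a) | a <- index_enum (arrow Q) & tgt a == vtx i].
Definition roots_out (i : 'I_(rho Q)) : seq Cxq :=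
  flatten [seq chern_roots (tgt a) | a <- index_enum (arrow Q) & src a == vtx i].

Definition chern_poly (i : 'I_(rho Q)) : {poly Cxq} :=
  \prod_(y <- roots_in i) ('X - y%:P)
  - ((-1) ^+ (r (vtx i)).-1 * qvar R r i)%:P * \prod_(y <- roots_out i) (y%:P - 'X).

Lemma qrel_horner i (k : 'I_(r (vtx i))) : qrel R k = (chern_poly i).[root_var k].
Proof.
rewrite /chern_poly hornerD hornerN hornerM hornerC !horner_prod.
rewrite /qrel /roots_in /roots_out !big_flatten !big_map !big_filter.
congr (_ - _ * _); apply: eq_bigr => a _; apply: eq_bigr => y _.
  by rewrite hornerXsubC.
by rewrite hornerD hornerN hornerX hornerC.
Qed.

Lemma qrel_atE v : qrel_at v = (chern_poly (block v)).['X_v].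
Proof. by rewrite /qrel_at qrel_horner /Defs.root_var root_rank_tagged. Qed.

Lemma prod_opp_sub (S : comNzRingType) (T : Type) (l : seq T) (f : T -> S) x :
  \prod_(y <- l) (f y - x) = (-1) ^+ size l * \prod_(y <- l) (x - f y).
Proof.
elim: l => [|y l ih]; first by rewrite !big_nil mulr1.
by rewrite !big_cons ih exprS mulrACA mulN1r opprB.
Qed.

Lemma chern_poly_over i : chern_poly i \is a polyOver in_chern.
Proof.
rewrite rpredB //.
  by rewrite big_flatten big_map rpred_prod // => a _; exact: chern_roots_over.
rewrite rpredM ?polyOverC ?rpredM ?rpredX ?rpredN1 ?in_chern_const //.
rewrite prod_opp_sub rpredM ?rpredX ?rpredN1 //.
by rewrite big_flatten big_map rpred_prod // => a _; exact: chern_roots_over.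
Qed.

(** [chern_poly] depends only on the block and has W-invariant coefficients, so W merely permutes
    the relations; hence [Iab] is W-stable. *)
Lemma msym_qrel_at (s : 'S_n) v : Wgroup s -> msym s (qrel_at v) = qrel_at (s v).
Proof.
move=> Ws; rewrite !qrel_atE; have -> : block (s v) = block v.
  by have /forallP /(_ v) /eqP := Ws.
have {2}<- : map_poly (msym s) (chern_poly (block v)) = chern_poly (block v).
  apply/polyP => k; rewrite coef_map /=.
  have /polyOverP /(_ k) /in_chern_invariant /W_invariantP := chern_poly_over (block v).
  exact.
by rewrite -msymXU horner_map.
Qed.

Lemma Iab_msym (s : 'S_n) (f : Cxq) : Wgroup s -> Iab f -> Iab (msym s f).
Proof.
move=> Ws /IabE [c ->]; rewrite rmorph_sum; apply: Iab_sum => v _ /=.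
rewrite msymM msym_qrel_at //; apply: IabM; apply/IabE.
by rewrite -[qrel_at _]mul1r; exact: in_ideal_gen.
Qed.

(** * Leading terms of the relations *)

Section Degrees.
Hypotheses (acyclicQ : ordered_acyclic Q) (r_source : r ord0 = 1%N) (fanoQ : fano r).

Lemma size_chern_roots v : size (chern_roots v) = r v.
Proof.
rewrite /Defs.chern_roots; case: unliftP => [i ->|->]; last by rewrite r_source.
by rewrite size_map size_enum_ord.
Qed.

Lemma size_roots_in i : size (roots_in i) = s_in r (vtx i).
Proof.
rewrite -sum1_size big_flatten big_map big_filter; apply: eq_bigr => a _.
by rewrite sum1_size size_chern_roots.
Qed.

Lemma size_roots_out i : size (roots_out i) = s_out r (vtx i).
Proof.
rewrite -sum1_size big_flatten big_map big_filter; apply: eq_bigr => a _.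
by rewrite sum1_size size_chern_roots.
Qed.

Lemma s_out_lt i : (s_out r (vtx i) < s_in r (vtx i))%N.
Proof. by have := fanoQ i; rewrite /anticanonical Num.Theory.subr_gt0 ltz_nat. Qed.

Lemma chern_poly_monic i :
  (size (chern_poly i) <= (s_in r (vtx i)).+1)%N /\ (chern_poly i)`_(s_in r (vtx i)) = 1.
Proof.
set s := s_in _ _; have out_lt := s_out_lt i.
pose P : {poly Cxq} := \prod_(y <- roots_in i) ('X - y%:P).
pose S : {poly Cxq} := ((-1) ^+ (r (vtx i)).-1 * qvar R r i)%:P * \prod_(y <- roots_out i) (y%:P - 'X).
have sP : size P = s.+1 by rewrite size_prod_XsubC size_roots_in.
have sS : (size S <= s)%N.
  rewrite /S prod_opp_sub mulrCA -signr_odd mulr_sign mul_polyC.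
  by case: odd; rewrite ?size_polyN (leq_trans (size_scale_leq _ _)) // size_prod_XsubC size_roots_out.
rewrite -[chern_poly i]/(P - S); split.
  rewrite (leq_trans (size_polyD _ _)) // size_polyN geq_max sP leqnn.
  exact: leq_trans sS _.
rewrite coefB [S`_s]nth_default // subr0 /P.
by have := monic_prod_XsubC (roots_in i) xpredT id; rewrite monicE /lead_coef -/P sP => /eqP.
Qed.

(** With M the shift and s'_i = [s_out], the quantum term at i has weight at most s'_i (M + rho), to
    be kept below s_i M. As s'_i + 1 <= s_i, it suffices that s'_i rho < M; the sum serves all i at
    once. *)
Definition weight_shift : nat := (\sum_i s_out r (vtx i) * rho Q)%N.+1.
Definition root_weight (v : 'I_n) : nat := (weight_shift + block v)%N.
Definition root_degree (v : 'I_n) : nat := s_in r (vtx (block v)).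
Local Notation wlt := (@wlt Cq n root_weight).

(** Block numbers are one less than vertex numbers, so a root at a non-source vertex [v] has weight
    [weight_shift + v - 1], strictly below the bound. *)
Lemma chern_root_wlt v y d : y \in chern_roots v ->
  (weight_shift + v <= d)%N -> y \in wlt d.
Proof.
rewrite /Defs.chern_roots; case: unliftP => [i ->|-> ]; last first.
  by rewrite inE => /eqP -> _; exact: rpred0.
case/mapP => k _ ->; rewrite wltX wtU /root_weight block_root_rank lift0 => ?; lia.
Qed.

Lemma qrel_lead v : lead_monic root_weight (qrel_at v) (U_(v) *+ root_degree v)%MM.
Proof.
set i := block v; have wtv : wt root_weight (U_(v) *+ root_degree v)%MM =
    (s_in r (vtx i) * (weight_shift + i))%N by rewrite wtMn wtU.
rewrite /lead_monic qrel_atE /chern_poly -/i hornerD hornerN hornerM hornerC !horner_prod.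
rewrite addrAC rpredB //.
  rewrite /root_degree -/i -size_roots_in.
  under eq_bigr do rewrite hornerXsubC.
  (* Arrows increase the vertex number, so the roots at the source of an incoming arrow weigh less
     than ['X_v]. *)
  have h y : y \in roots_in i -> lead_monic root_weight ('X_v - y) U_(v)%MM.
    case/flatten_mapP => a; rewrite mem_filter => /andP[/eqP ta _] ya.
    rewrite /lead_monic addrAC subrr sub0r rpredN wtU /root_weight.
    have sa : (src a <= i)%N by have := acyclicQ a; rewrite ta lift0.
    by apply: chern_root_wlt ya _; rewrite -/i; lia.
  elim: (roots_in i) h => [|y l ih] h.
    by rewrite big_nil mulm0n; exact: lead_monic1.
  rewrite big_cons mulmS; apply: lead_monicM; first exact/h/mem_head.
  by apply: ih => z zl; apply: h; rewrite inE zl orbT.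
under eq_bigr do rewrite hornerD hornerN hornerX hornerC.
set D := (weight_shift + rho Q)%N.
have out_wlt : \prod_(y <- roots_out i) (y - 'X_v) \in wlt (size (roots_out i) * D).+1.
  have h y : y \in roots_out i -> y - 'X_v \in wlt D.+1.
    case/flatten_mapP => a _ ya; apply: rpredB.
      by apply: chern_root_wlt ya _; have := ltn_ord (tgt a); rewrite /D; lia.
    by rewrite wltX wtU /root_weight /D ltnS leq_add2l ltnW.
  elim: (roots_out i) h => [|y l ih] h.
    by rewrite big_nil -mpolyX0 wltX wt0.
  rewrite big_cons mulSn -addSn; apply: wltM; first exact/h/mem_head.
  by apply: ih => z zl; apply: h; rewrite inE zl orbT.
(* The quantum parameter is a coefficient, hence of weight zero. *)
have const_wlt : (-1) ^+ (r (vtx i)).-1 * qvar R r i \in wlt 1.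
  rewrite -signr_odd mulr_sign; have q1 : qvar R r i \in wlt 1.
    by rewrite /qvar -alg_mpolyC wltZ // -mpolyX0 wltX wt0.
  by case: odd; rewrite ?rpredN.
apply: wltW (wltM const_wlt out_wlt); rewrite wtv size_roots_out /D.
have := s_out_lt i; have : (s_out r (vtx i) * rho Q < weight_shift)%N.
  by rewrite ltnS (bigD1 i) //= leq_addr.
set a := s_out _ _; set b := s_in _ _ => h1 h2.
apply: leq_trans (leq_mul h2 (leq_addr i _)); rewrite mulSn mulnDr; lia.
Qed.

End Degrees.

(** * Products of polynomials over the blocks of Chern roots *)

Definition block_exponent (i : 'I_(rho Q)) (a : 'X_{1..n}) : 'X_{1..r (vtx i)} :=
  [multinom a (@Defs.root_rank Q r i k) | k < r (vtx i)].

Definition block_prod (p : forall i : 'I_(rho Q), {mpoly Cq[r (vtx i)]}) : Cxq :=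
  \prod_i in_roots (p i).

HB.instance Definition _ i := GRing.LRMorphism.copy (@in_roots R Q r i)
  (comp_mpoly [tuple root_var k | k < r (vtx i)]).

Lemma eq_block_prod p p' : (forall i, p i = p' i) -> block_prod p = block_prod p'.
Proof. by move=> e; apply: eq_bigr => i _; rewrite e. Qed.

Lemma block_prodM p p' :
  block_prod (fun i => p i * p' i) = block_prod p * block_prod p'.
Proof. by rewrite -big_split; apply: eq_bigr => i _; rewrite rmorphM. Qed.

Lemma block_prodZ (c : 'I_(rho Q) -> Cq) p :
  block_prod (fun i => c i *: p i) = (\prod_i c i) *: block_prod p.
Proof.
by rewrite /block_prod -scaler_prod; apply: eq_bigr => i _; rewrite linearZ.
Qed.

Lemma block_prod_monomial a : block_prod (fun i => 'X_[block_exponent i a]) = 'X_[a].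
Proof.
rewrite mpolyXE_id [RHS](reindex (@enum_rank (root_index r))); last exact/onW_bij/enum_rank_bij.
transitivity (\prod_i \prod_(k < r (vtx i)) 'X_(root_rank k) ^+ a (root_rank k) : Cxq).
  apply: eq_bigr => i _; rewrite /in_roots comp_mpolyX; apply: eq_bigr => k _.
  by rewrite tnth_mktuple mnmE.
by rewrite sig_big_dep; apply: eq_bigr => -[i k].
Qed.

Definition Omega : Cxq := block_prod (fun i => alternant Cq (@delta (r (vtx i)))).

Lemma omega_Omega : exists b : nat, omega R r = (-1) ^+ b * Omega.
Proof.
have [b bE] := choice (fun i => signed_vandermonde Cq (r (vtx i))).
exists (\sum_i b i)%N; rewrite -prodrXr /Omega /block_prod -big_split.
apply: eq_bigr => i _ /=.
have := congr1 (@in_roots R Q r i) (bE i).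
rewrite rmorphM rmorphXn rmorphN1 => <-.
rewrite rmorph_prod; apply: eq_bigr => j _; rewrite rmorph_prod; apply: eq_bigr => k _.
by rewrite rmorphB /= !in_rootsXU.
Qed.

Lemma Iq_Omega (f : CxqW R r) : f \in @Iq R Q r <-> Iab (Omega * inv_val f).
Proof.
have [b bE] := omega_Omega; split=> [/asboolP|h]; last first.
  by apply/asboolP; rewrite bE -mulrA; exact: IabM.
move=> /(IabM ((-1) ^+ b)); rewrite bE !mulrA -exprD addnn -mul2n exprM sqrrN expr1n expr1n mul1r.
by [].
Qed.

(** * Permutations of one block and antisymmetrization *)

Lemma block_perm_ex i (t : 'S_(r (vtx i))) : exists s : 'S_n,
  (forall k : 'I_(r (vtx i)), s (root_rank k) = root_rank (t k)) /\
  forall v, block v != i -> s v = v.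
Proof.
have [s [h1 h2]] := extend_perm t (@root_rank_inj i); exists s; split=> // v vi.
by apply: h2 => k; apply: contraNneq vi => ->; rewrite block_root_rank.
Qed.

Definition block_perm i (t : 'S_(r (vtx i))) : 'S_n := sval (cid (block_perm_ex t)).

Lemma block_permE i (t : 'S_(r (vtx i))) k :
  block_perm t (root_rank k) = root_rank (t k).
Proof. by rewrite /block_perm; case: cid => s []. Qed.

Lemma block_perm_id i (t : 'S_(r (vtx i))) v : block v != i -> block_perm t v = v.
Proof. by move=> vi; rewrite /block_perm; case: cid => s [_ h] /=; exact: h. Qed.

Lemma Wgroup_block_perm i (t : 'S_(r (vtx i))) : Wgroup (block_perm t).
Proof.
apply/forallP => v; rewrite -!/(block _).
have [/root_rankP [k ->]|vi] := eqVneq (block v) i; last by rewrite block_perm_id.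
by rewrite block_permE !block_root_rank.
Qed.

Lemma msym_in_roots i (t : 'S_(r (vtx i))) (p : {mpoly Cq[r (vtx i)]}) :
  msym (block_perm t) (in_roots p) = in_roots (msym t p).
Proof. by apply: msym_comp => k; exact: block_permE. Qed.

Lemma msym_in_roots_other i j (t : 'S_(r (vtx i))) (p : {mpoly Cq[r (vtx j)]}) :
  j != i -> msym (block_perm t) (in_roots p) = in_roots p.
Proof.
move=> ji; rewrite -[in RHS](msym1m p); apply: msym_comp => k.
by rewrite perm1 block_perm_id // block_root_rank.
Qed.

Definition antisym m (p : {mpoly Cq[m]}) : {mpoly Cq[m]} :=
  \sum_(t : 'S_m) (-1) ^+ t * msym t p.

Definition antisym_block i (f : Cxq) : Cxq :=
  \sum_(t : 'S_(r (vtx i))) (-1) ^+ t * msym (block_perm t) f.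

Lemma antisym_block_linear i : linear (antisym_block i).
Proof.
move=> c f g; rewrite scaler_sumr -big_split; apply: eq_bigr => t _ /=.
by rewrite msymD msymZ mulrDr scalerAr.
Qed.
HB.instance Definition _ i :=
  GRing.isLinear.Build Cq Cxq Cxq *:%R (antisym_block i) (antisym_block_linear i).

Lemma antisym_blockB i f g : antisym_block i (f - g) = antisym_block i f - antisym_block i g.
Proof. exact: linearB. Qed.

Lemma antisym_blockZ i c f : antisym_block i (c *: f) = c *: antisym_block i f.
Proof. exact: linearZ. Qed.

Lemma antisym_block_sum i (I : Type) (l : seq I) (F : I -> Cxq) :
  antisym_block i (\sum_(j <- l) F j) = \sum_(j <- l) antisym_block i (F j).
Proof. exact: linear_sum. Qed.

Lemma antisym_block_Iab i f : Iab f -> Iab (antisym_block i f).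
Proof.
move=> hf; apply: Iab_sum => t _; apply: IabM; apply: Iab_msym hf.
exact: Wgroup_block_perm.
Qed.

Lemma msym_block_prod i (t : 'S_(r (vtx i))) p : msym (block_perm t) (block_prod p) =
  in_roots (msym t (p i)) * \prod_(j | j != i) in_roots (p j).
Proof.
rewrite /block_prod (bigD1 i) // msymM msym_in_roots; congr (_ * _); rewrite [LHS]rmorph_prod.
by apply: eq_bigr => j; exact: msym_in_roots_other.
Qed.

Lemma antisym_block_prod i p : antisym_block i (block_prod p) =
  block_prod (fun j => if j == i then antisym (p j) else p j).
Proof.
rewrite [RHS]/block_prod (bigD1 i) //= eqxx.
rewrite [X in _ = _ * X](eq_bigr (fun j => in_roots (p j))) => [|j /negbTE ->] //.
rewrite /antisym_block /antisym [in_roots _]rmorph_sum mulr_suml; apply: eq_bigr => t _.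
by rewrite msym_block_prod mulrA rmorphM rmorphXn rmorphN1.
Qed.

Lemma msym_Omega i (t : 'S_(r (vtx i))) : msym (block_perm t) Omega = (-1) ^+ t * Omega.
Proof.
have OmegaE : Omega = in_roots (alternant Cq (@delta (r (vtx i)))) *
    \prod_(j | j != i) in_roots (alternant Cq (@delta (r (vtx j)))).
  by rewrite /Omega /block_prod (bigD1 i).
rewrite msym_block_prod msym_alternant rmorphM rmorphXn rmorphN1 -mulrA.
by congr (_ * _); rewrite OmegaE.
Qed.

(** [Omega] is antisymmetric in the block and [f] is invariant, so all summands agree. *)
Lemma antisym_block_Omega i (f : CxqW R r) :
  antisym_block i (Omega * inv_val f) = (r (vtx i))`!%:R *: (Omega * inv_val f).
Proof.
rewrite /antisym_block (eq_bigr (fun=> Omega * inv_val f)) => [|t _].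
  by rewrite sumr_const card_Sn scaler_nat.
rewrite msymM msym_Omega; have /W_invariantP -> := valP f; last exact: Wgroup_block_perm.
by rewrite mulrA mulrA -expr2 sqrr_sign mul1r.
Qed.

Definition schur_rep (l : box_family r) : CxqW R r :=
  \prod_i sym_in_roots (schur_sym Cq (box_parts (l i))).

Lemma schur_productE l : schur_product R l = qclass (schur_rep l).
Proof. by rewrite /schur_rep [RHS]rmorph_prod. Qed.

Lemma Omega_schur_rep l : Omega * inv_val (schur_rep l) =
  block_prod (fun i => alternant Cq (box_exponent (l i))).
Proof.
have -> : inv_val (schur_rep l) = block_prod (fun i => schur Cq (box_parts (l i))).
  by rewrite -[LHS]/(\val (schur_rep l)) [LHS]rmorph_prod.
rewrite -block_prodM; apply: eq_block_prod => i.
by rewrite mulrC; exact: schurE.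
Qed.

(** [l] lists the blocks already treated. Antisymmetrizing one more block preserves [Iab],
    contributes a factorial on the left and turns a monomial factor into an alternant on the
    right. *)
Lemma antisymmetrize (f : CxqW R r) (g : Cxq) (l : seq 'I_(rho Q)) :
  Iab (Omega * inv_val f - g) -> uniq l ->
  Iab ((\prod_(i <- l) (r (vtx i))`!%:R) *: (Omega * inv_val f) -
    \sum_(a <- msupp g) g@_a *: block_prod (fun j =>
      if j \in l then alternant Cq (block_exponent j a) else 'X_[block_exponent j a])).
Proof.
move=> hf; elim: l => [_|i l ih /andP[il /ih {}ih]].
  rewrite big_nil scale1r; congr (Iab (_ - _)): hf.
  by rewrite {1}[g]mpolyE; apply: eq_bigr => a _; rewrite block_prod_monomial.
have stepE a : antisym_block i (block_prod (fun j =>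
      if j \in l then alternant Cq (block_exponent j a) else 'X_[block_exponent j a])) =
    block_prod (fun j =>
      if j \in i :: l then alternant Cq (block_exponent j a) else 'X_[block_exponent j a]).
  rewrite antisym_block_prod; apply: eq_block_prod => j; rewrite inE.
  have [->|ji] := eqVneq j i; last by [].
  by rewrite (negbTE il); exact: antisymmetrize_monomial.
have := antisym_block_Iab i ih.
rewrite antisym_blockB antisym_blockZ antisym_block_sum antisym_block_Omega.
rewrite scalerA -[_ * _`!%:R]mulrC big_cons.
set S1 := (X in Iab (_ - X) -> _); set S2 := (X in _ -> Iab (_ - X)).
have -> // : S1 = S2.
by apply: eq_bigr => a _; rewrite antisym_blockZ stepE.
Qed.

(** * Coefficients of products over the blocks *)

Lemma mcoeff_mulX (f : Cxq) a b :
  (f * 'X_[b])@_a = if (b <= a)%MM then f@_(a - b)%MM else 0.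
Proof.
case: (boolP (b <= a)%MM) => [ba|nba].
  by rewrite -{1}(submK ba) addmC mcoeffMX.
apply/eqP; rewrite mcoeff_eq0; apply: contraNN nba => /msuppM_le /allpairsP [[c d] /= [_]].
rewrite msuppX inE => /eqP -> ->; apply/mnm_lepP => v.
by rewrite mnmDE leq_addl.
Qed.

Definition block_lift i (b : 'X_{1..r (vtx i)}) : 'X_{1..n} :=
  (\sum_k U_(@Defs.root_rank Q r i k) *+ b k)%MM.

Lemma block_lift_in i (b : 'X_{1..r (vtx i)}) k : block_lift b (root_rank k) = b k.
Proof.
rewrite /block_lift mnm_sumE (bigD1 k) //= mulmnE mnm1E eqxx mul1n big1 ?addn0 // => j jk.
by rewrite mulmnE mnm1E (inj_eq (@root_rank_inj i)) (negbTE jk).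
Qed.

Lemma block_lift_out i (b : 'X_{1..r (vtx i)}) v : block v != i -> block_lift b v = 0%N.
Proof.
move=> vi; rewrite /block_lift mnm_sumE big1 // => k _; rewrite mulmnE mnm1E.
suff /negbTE -> : root_rank k != v by [].
by apply: contraNneq vi => <-; rewrite block_root_rank.
Qed.

Lemma in_rootsX i (b : 'X_{1..r (vtx i)}) : in_roots 'X_[b] = 'X_[block_lift b] :> Cxq.
Proof.
rewrite /in_roots comp_mpolyX -mprodXnE; apply: eq_bigr => k _.
by rewrite tnth_mktuple.
Qed.

(** The blocks use disjoint variables, so coefficients multiply. The condition on [v] accounts for
    partial lists in the induction; for the full list of blocks it is void. *)
Lemma mcoeff_prod_in_roots (l : seq 'I_(rho Q)) (p : forall i, {mpoly Cq[r (vtx i)]}) a :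
  uniq l ->
  (\prod_(i <- l) in_roots (p i))@_a =
  if [forall v, (block v \notin l) ==> (a v == 0%N)]
  then \prod_(i <- l) (p i)@_(block_exponent i a) else 0.
Proof.
elim: l a => [|i l ih] a.
  rewrite !big_nil mcoeff1; have [->|ane] := eqVneq a 0%MM.
    by have -> : [forall v, (block v \notin [::]) ==> (0%MM v == 0%N)] by apply/forallP => v; rewrite mnm0E.
  case: ifP => [/forallP h|_]; last by rewrite /= mulr0n.
  by case/eqP: ane; apply/mnmP => v; rewrite mnm0E; exact/eqP/h.
case/andP=> il ul; rewrite !big_cons; set G := \prod_(j <- l) _; set P' := \prod_(j <- l) _.
(* The case of a monomial in block [i]; the general factor follows by linearity. *)
have key b : (G * 'X_[block_lift b])@_a =
    if [forall v, (block v \notin i :: l) ==> (a v == 0%N)] && (b == block_exponent i a)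
    then P' else 0.
  rewrite mcoeff_mulX; case: (boolP (_ <= a)%MM) => [/mnm_lepP ba|nba]; last first.
    case: andP => // -[/forallP h /eqP bE]; case/mnm_lepP: nba => v.
    have [/root_rankP [k ->]|vi] := eqVneq (block v) i; last by rewrite block_lift_out.
    by rewrite block_lift_in bE mnmE.
  rewrite /G ih //.
  have -> : \prod_(j <- l) (p j)@_(block_exponent j (a - block_lift b)%MM) = P'.
    apply: eq_big_seq => j jl; congr (_@_ _); apply/mnmP => k; rewrite !mnmE.
    rewrite block_lift_out ?subn0 // block_root_rank.
    by apply: contraNneq il => <-.
  congr (if _ then _ else _); apply/forallP/andP => [h|[/forallP h /eqP bE] v].
    split.
      apply/forallP => v; apply/implyP; rewrite inE negb_or => /andP[vi vl].
      by have := h v; rewrite vl mnmBE block_lift_out ?subn0.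
    apply/eqP/mnmP => k; rewrite mnmE; have := h (root_rank k); have := ba (root_rank k).
    by rewrite block_root_rank il mnmBE block_lift_in /= subn_eq0; lia.
  apply/implyP => vl; rewrite mnmBE.
  have [/root_rankP [k ->]|vi] := eqVneq (block v) i.
    by rewrite block_lift_in bE mnmE subnn.
  by have := h v; rewrite inE (negbTE vi) (negbTE vl) /= => /eqP ->.
clearbody G P'; elim/mpolyind: (p i) => [|c b q _ _ ihq].
  by rewrite raddf0 mul0r !mcoeff0 mul0r if_same.
have -> : in_roots (c *: 'X_[b] + q) = c *: 'X_[block_lift b] + in_roots q :> Cxq.
  by rewrite -in_rootsX /in_roots comp_mpolyD comp_mpolyZ.
have -> : (c *: 'X_[block_lift b] + in_roots q) * G = c *: (G * 'X_[block_lift b]) + in_roots q * G.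
  by rewrite mulrDl -(scalerAl c) [G * _]mulrC.
rewrite mcoeffD ihq mcoeffZ key mcoeffD mcoeffZ mcoeffX.
case: [forall v, _] => /=; last by rewrite mulr0 addr0.
by rewrite mulrDl mulr_natb_if.
Qed.

Lemma in_roots_alternant i e :
  in_roots (alternant Cq e) = \det (\matrix_(j, k < r (vtx i)) root_var k ^+ e j).
Proof.
have powE j k : in_roots ('X_k ^+ e j : {mpoly Cq[r (vtx i)]}) = root_var k ^+ e j.
  by rewrite -in_rootsXU /in_roots rmorphXn.
rewrite /alternant -[LHS](det_map_mx (@in_roots R Q r i)); congr (\det _).
by apply/matrixP => j k; rewrite !mxE; exact: powE.
Qed.

(** * Spanning and independence of the Schur products *)

Section Basis.
Hypotheses (acyclicQ : ordered_acyclic Q) (r_source : r ord0 = 1%N) (fanoQ : fano r).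
Hypothesis s_gt_r : forall i : 'I_(rho Q), (0 < s_in r (vtx i) - r (vtx i))%N.

Lemma root_degree_gt0 v : (0 < root_degree v)%N.
Proof. by have := s_gt_r (block v); rewrite /root_degree; lia. Qed.

Lemma block_prod_alternant (a : 'X_{1..n}) : (forall v, a v < root_degree v)%N ->
  exists (c : Cq) (l : box_family r),
    block_prod (fun i => alternant Cq (block_exponent i a)) = c *: (Omega * inv_val (schur_rep l)).
Proof.
move=> ared.
have ex i : exists x : Cq * box_partition (r (vtx i)) (s_in r (vtx i) - r (vtx i)),
    alternant Cq (block_exponent i a) = x.1 *: alternant Cq (box_exponent x.2).
  have [k|c [l e]] := @alternant_box Cq _ (s_in r (vtx i) - r (vtx i)) (block_exponent i a).
    rewrite mnmE (leq_trans (ared _)) // /root_degree block_root_rank.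
    by have := s_gt_r i; lia.
  by exists (c, l).
pose x i := projT1 (cid (ex i)); have xE i := projT2 (cid (ex i)).
exists (\prod_i (x i).1), [ffun i => (x i).2].
rewrite Omega_schur_rep -block_prodZ; apply: eq_block_prod => i.
by rewrite ffunE; exact: xE.
Qed.

Lemma schur_product_span (x : QH R r) :
  exists c : {ffun box_family r -> Cq}, x = \sum_l c l *: schur_product R l.
Proof.
pose span x := exists c : {ffun box_family r -> Cq}, x = \sum_l c l *: schur_product R l.
have spanD y z : span y -> span z -> span (y + z).
  case=> c -> [d ->]; exists [ffun l => c l + d l]; rewrite -big_split.
  by apply: eq_bigr => l _; rewrite ffunE scalerDl.
have spanZ k y : span y -> span (k *: y).
  case=> c ->; exists [ffun l => k * c l]; rewrite scaler_sumr.
  by apply: eq_bigr => l _; rewrite ffunE scalerA.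
have span0 : span 0.
  by exists [ffun=> 0]; rewrite big1 // => l _; rewrite ffunE scale0r.
have spanS l : span (schur_product R l).
  exists [ffun l' => (l' == l)%:R]; rewrite (bigD1 l) //= ffunE eqxx scale1r.
  by rewrite big1 ?addr0 // => l' /negbTE ll; rewrite ffunE ll scale0r.
have [f ->] := qclass_surj x.
have lead := qrel_lead acyclicQ r_source fanoQ.
(* It is [Omega * inv_val f], not [f], that is reduced; the remainder [g] need not be antisymmetric,
   whence the next step. *)
have [g gred /IabE fg] := ideal_reduce root_degree_gt0 lead (Omega * inv_val f).
have := antisymmetrize fg (index_enum_uniq _).
set N := \prod_(i <- _) _; set S := (X in Iab (_ - X) -> _).
(* The product of factorials is a nonzero complex number, hence invertible in [Cq]. *)
have [N' NN'] : exists N' : Cq, N' * N = 1.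
  exists ((\prod_i (r (vtx i))`!)%:R^-1)%:MP.
  have -> : N = ((\prod_i (r (vtx i))`!)%:R : R[i])%:MP by rewrite rmorph_nat natr_prod.
  rewrite -mpolyCM mulVf // Num.Theory.pnatr_eq0 -lt0n; apply: prodn_gt0 => i.
  exact: fact_gt0.
have [h hspan hE] : exists2 h, span (qclass h) & S = Omega * inv_val h.
  rewrite /S big_seq; elim/big_ind: _ => [|y z [h1 s1 ->] [h2 s2 ->]|a ag].
  - by exists 0; rewrite ?raddf0 // mulr0.
  - by exists (h1 + h2); rewrite ?raddfD ?mulrDr //; exact: spanD.
  have ared : forall v, (a v < root_degree v)%N.
    by apply: (reducedP _ _ gred); rewrite -mcoeff_msupp.
  have [c [l e]] := block_prod_alternant ared.
  exists ((g@_a * c) *: schur_rep l); first by rewrite linearZ /= -schur_productE; exact/spanZ/spanS.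
  rewrite (@eq_block_prod _ (fun i => alternant Cq (block_exponent i a))) => [|j]; last by rewrite mem_index_enum.
  by rewrite e scalerA scalerAr.
rewrite hE => hI; have : qclass (N *: f) = qclass h.
  apply/qclass_eq/Iq_Omega; move: hI; congr (Iab _).
  by rewrite mulrBr scalerAr.
rewrite linearZ /= => /(congr1 ( *:%R N')); rewrite scalerA NN' scale1r => ->.
exact: spanZ.
Qed.

Definition box_monomial (l : box_family r) : 'X_{1..n} :=
  [multinom box_exponent (l (block v)) (tagged (enum_val v)) | v < n].

Lemma block_exponent_box l i :
  block_exponent i (box_monomial l) = [multinom box_exponent (l i) k | k < r (vtx i)].
Proof. by apply/mnmP => k; rewrite !mnmE /block enum_rankK. Qed.

Local Notation box_alternant l :=
  (block_prod (fun i => alternant Cq (box_exponent (l i)))).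

(** In each block only the decreasing monomial is tested, so the coefficients at box monomials are
    coordinates dual to the box alternants. *)
Lemma mcoeff_box_alternant (l l' : box_family r) :
  (box_alternant l)@_(box_monomial l') = (l == l')%:R.
Proof.
rewrite mcoeff_prod_in_roots ?index_enum_uniq // ifT; last first.
  by apply/forallP => v; rewrite mem_index_enum.
have coefE i : (alternant Cq (box_exponent (l i)))@_(block_exponent i (box_monomial l')) =
    (l i == l' i)%:R.
  rewrite block_exponent_box mcoeff_alternant.
  - have [->|ll] := eqVneq (l i) (l' i); first by rewrite eqxx.
    suff /negbTE -> : [multinom box_exponent (l i) k | k < r (vtx i)] !=
        [multinom box_exponent (l' i) k | k < r (vtx i)] by [].
    apply: contraNneq ll => /mnmP h; apply/eqP/box_exponent_inj => k.
    by have := h k; rewrite !mnmE.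
  - exact: box_exponent_decreasing.
  by move=> j k jk; rewrite !mnmE; exact: box_exponent_decreasing.
rewrite (eq_bigr _ (fun i _ => coefE i)); have [->|ll] := eqVneq l l'.
  by rewrite big1 // => i _; rewrite eqxx.
have [i li] : exists i, l i != l' i.
  apply: contrapT => nex; case/eqP: ll; apply/ffunP => i; apply/eqP.
  by apply: contrapT => /negP li; apply: nex; exists i.
by rewrite (bigD1 i) //= (negbTE li) mul0r.
Qed.

Lemma box_alternant_reduced (l : box_family r) a :
  (box_alternant l)@_a != 0 -> forall v, (a v < root_degree v)%N.
Proof.
rewrite mcoeff_prod_in_roots ?index_enum_uniq //; case: ifP; last by rewrite eqxx.
move=> _ /prodf_neq0 h v; have := h (block v) isT.
have lt k := box_exponent_lt (l (block v)) k.
move=> /(mcoeff_alternant_lt lt); have [k vk] := root_rankP (erefl (block v)).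
move=> /(_ k); rewrite mnmE -vk /root_degree; have := s_gt_r (block v); lia.
Qed.

(** After multiplication by [Omega] the combination is reduced and lies in [Iab], hence is zero; its
    coefficients at box monomials are the [c l]. *)
Lemma schur_product_free (c : box_family r -> Cq) :
  \sum_l c l *: schur_product R l = 0 -> forall l, c l = 0.
Proof.
move=> c0; have : Iab (Omega * inv_val (\sum_l c l *: schur_rep l)).
  apply/Iq_Omega; rewrite -[X in X \in _]subr0; apply/qclass_eq.
  rewrite linear_sum [RHS]raddf0 -[RHS]c0; apply: eq_bigr => l _.
  by rewrite linearZ schur_productE.
have -> : Omega * inv_val (\sum_l c l *: schur_rep l) = \sum_l c l *: box_alternant l.
  have -> : inv_val (\sum_l c l *: schur_rep l) = \sum_l c l *: inv_val (schur_rep l).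
    exact: (raddf_sum (\val : CxqW R r -> Cxq)).
  rewrite mulr_sumr; apply: eq_bigr => l _.
  by rewrite -scalerAr Omega_schur_rep.
have coefS a : (\sum_l c l *: box_alternant l)@_a = \sum_l c l * (box_alternant l)@_a.
  by rewrite [LHS]raddf_sum; apply: eq_bigr => l _; exact: mcoeffZ.
have Sred : \sum_l c l *: box_alternant l \in reduced root_degree.
  apply/reducedP => a; rewrite coefS => a0.
  have [l la] : exists l : box_family r, (box_alternant l)@_a != 0.
    apply: contrapT => nex; case/eqP: a0; apply: big1 => l _.
    have [->|la] := eqVneq (box_alternant l)@_a 0; first by rewrite mulr0.
    by case: nex; exists l.
  exact: box_alternant_reduced la.
move=> /IabE /(ideal_reduced0 root_degree_gt0 (qrel_lead acyclicQ r_source fanoQ)).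
move=> /(_ Sred) S0 l.
have : \sum_l' c l' * (box_alternant l')@_(box_monomial l) = 0 by rewrite -coefS S0 mcoeff0.
have termE l' : c l' * (box_alternant l')@_(box_monomial l) = if l' == l then c l' else 0.
  by rewrite mcoeff_box_alternant; case: eqP => _; [rewrite mulr1|rewrite mulr0].
rewrite (eq_bigr _ (fun l' _ => termE l')).
by rewrite -big_mkcond big_pred1_eq.
Qed.

(** * The expansion in rim-hook removals *)

Lemma chern_poly_reduction i k e : (s_in r (vtx i) <= e)%N ->
  exists g : Cxq, (root_var k : Cxq) ^+ e + \sum_(1 <= n < (s_in r (vtx i)).+1)
    (chern_poly i)`_(s_in r (vtx i) - n) * root_var k ^+ (e - n) = g * @qrel R Q r i k.
Proof.
set s := s_in _ _ => se; have [sp ps] := chern_poly_monic r_source fanoQ i.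
exists (root_var k ^+ (e - s)); rewrite qrel_horner (horner_coef_wide _ sp) big_ord_recr /= ps mul1r.
rewrite mulrDr -exprD subnK // addrC; congr (_ + _).
rewrite big_add1 big_mkord mulr_sumr [RHS](reindex_inj rev_ord_inj).
apply: eq_bigr => n _ /=; rewrite mulrCA -exprD; congr (_ * _ ^+ _).
by rewrite addnBA ?subnK //; exact: (ltn_ord n).
Qed.

(* The hypotheses on [u] and [v] say that, up to the antisymmetrizing factor
   [A], they are the determinants [\det (x_j ^+ e_i)] whose first row has exponent
   [e] and [e - n], expanded along that row. *)
Lemma first_row_reduction i (A B : Cxq) (c : 'I_(r (vtx i)) -> Cxq) e (u : CxqW R r)
    (v : nat -> CxqW R r) (P : nat -> CxqW R r) :
  (s_in r (vtx i) <= e)%N -> Omega = A * B ->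
  A * inv_val u = \sum_j root_var j ^+ e * c j ->
  (forall n, (0 < n <= s_in r (vtx i))%N ->
    A * inv_val (v n) = \sum_j root_var j ^+ (e - n) * c j) ->
  (forall n, inv_val (P n) = - (chern_poly i)`_(s_in r (vtx i) - n)) ->
  qclass u = \sum_(1 <= n < (s_in r (vtx i)).+1) qclass (P n) * qclass (v n).
Proof.
set s := s_in _ _ => s_le OmegaE uE vE PE.
transitivity (qclass (\sum_(1 <= n < s.+1) P n * v n)); last first.
  by rewrite linear_sum; apply: eq_bigr => n _; exact: rmorphM.
apply/qclass_eq/Iq_Omega; rewrite OmegaE [A * B]mulrC -mulrA; apply: IabM.
have invE : inv_val (u - \sum_(1 <= n < s.+1) P n * v n) =
    inv_val u - \sum_(1 <= n < s.+1) inv_val (P n) * inv_val (v n).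
  have <- : inv_val (\sum_(1 <= n < s.+1) P n * v n) =
      \sum_(1 <= n < s.+1) inv_val (P n) * inv_val (v n).
    exact: (raddf_sum (\val : CxqW R r -> Cxq)).
  by [].
have termE n : (1 <= n < s.+1)%N -> A * (inv_val (P n) * inv_val (v n)) =
    - \sum_j (chern_poly i)`_(s - n) * root_var j ^+ (e - n) * c j.
  by move=> ns; exact: mulr_expansion (vE n ns) (PE n).
rewrite invE mulrBr uE mulr_sumr (eq_big_nat _ _ termE) sumrN opprK exchange_big.
rewrite -big_split; apply: Iab_sum => j _ /=; rewrite -mulr_suml -mulrDl.
by have [g ->] := chern_poly_reduction j s_le; rewrite mulrAC; exact: Iab_gen.
Qed.

Lemma rim_hook_expansion i (mu : (r (vtx i)).-tuple nat) :
  (0 < r (vtx i))%N -> is_partition mu ->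
  (s_in r (vtx i) - r (vtx i) + 1 <= nth 0 mu 0)%N ->
  exists (N : nat) (P : nat -> {mpoly Cq[n]}),
    schurQ R mu =
      \sum_(1 <= n < N.+1) chern_eval (P n) * RH (@schurQ R Q r i) n mu.
Proof.
move=> r_gt0 mu_part mu_wide; set s := s_in r (vtx i) in mu_wide.
(* The first exponent of mu + delta. Being too wide for the box means precisely [s <= e0], so no
   [e0 - n] with [n <= s] truncates. *)
pose e0 := (nth 0%N mu 0 + (r (vtx i)).-1)%N.
have s_le : (s <= e0)%N by have := s_gt_r i; rewrite -/s /e0; lia.
have coefP k : exists P, inv_val (chern_value P) = - (chern_poly i)`_k.
  have : - (chern_poly i)`_k \in in_chern by rewrite rpredN; exact: (polyOverP (chern_poly_over i)).
  by case/asboolP => P ->; exists P.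
pose P n := projT1 (cid (coefP (s - n)%N)).
have PE n : inv_val (chern_value (P n)) = - (chern_poly i)`_(s - n) := projT2 (cid (coefP _)).
exists s, P.
pose S (l : (r (vtx i)).-tuple nat) : CxqW R r := sym_in_roots (schur_sym Cq l).
have RH_S n : RH (@schurQ R Q r i) n mu = qclass (RH S n mu).
  by apply: (@RH_natural _ _ (@qclass R Q r)) => [|x]; [exact: raddf0|exact: raddfN].
(* The factor of [Omega] from block [i]; [mu] does not touch the other blocks, whose factors are
   only multiplied in at the end. *)
pose A : Cxq := in_roots (alternant Cq (@delta (r (vtx i)))).
have [c cE] := det_powers_expand_row0 (fun k => root_var k : Cxq)
  (fun j => tnth mu j + delta j)%N r_gt0.
have A_S l : A * inv_val (S l) = in_roots (alternant Cq (fun j => tnth l j + delta j)%N).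
  by rewrite -schurE mulrC rmorphM.
have A_mu : A * inv_val (S mu) = \sum_j root_var j ^+ e0 * c j.
  rewrite A_S in_roots_alternant -[RHS]cE; congr (\det _); apply/matrixP => j k.
  rewrite !mxE; congr (_ ^+ _); case: eqP => // j0.
  by rewrite (tnth_nth 0%N) /delta j0 subn1.
have A_RH n : (0 < n <= s)%N ->
    A * inv_val (RH S n mu) = \sum_j root_var j ^+ (e0 - n) * c j.
  move=> ns; have n_bounds : (0 < n <= nth 0 mu 0 + (r (vtx i)).-1)%N by rewrite -/e0; lia.
  have RHE := RH_alternant_pos Cq r_gt0 mu_part n_bounds.
  rewrite -(@RH_natural _ _ (fun u => A * inv_val u)) => [||x].
  - have -> : (fun l => A * inv_val (S l)) =
        (fun l => in_roots (alternant Cq (fun j => tnth l j + delta j)%N)).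
      by apply: funext => l; exact: A_S.
    rewrite (@RH_natural _ _ (@in_roots R Q r i)) => [||x]; [|exact: raddf0|exact: raddfN].
    by rewrite RHE in_roots_alternant; exact: cE.
  - exact: mulr0.
  exact: mulrN.
have OmegaE : Omega = A * \prod_(j | j != i) in_roots (alternant Cq (@delta (r (vtx j)))).
  by rewrite /Omega /block_prod (bigD1 i).
rewrite (eq_bigr _ (fun n _ => congr1 (fun x => chern_eval (P n) * x) (RH_S n))).
exact: first_row_reduction s_le OmegaE A_mu A_RH PE.
Qed.

End Basis.
End Presentation.

Theorem theorem0p3 (R : realType) (Q : quiver) (r : vertex Q -> nat)
    (acyclicQ : ordered_acyclic Q) (sourceQ : unique_source Q)
    (r_pos : forall v, (0 < r v)%N) (r_source : r ord0 = 1%N)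
    (s_gt_r : forall i : 'I_(rho Q), (0 < s_in r (vtx i) - r (vtx i))%N)
    (reducedQ : graph_reduced r) (fanoQ : fano r) :
  is_basis (@schur_product R Q r) /\
  forall (i : 'I_(rho Q)) (mu : (r (vtx i)).-tuple nat),
    is_partition mu ->
    (s_in r (vtx i) - r (vtx i) + 1 <= nth 0 mu 0)%N ->
    exists (N : nat) (P : nat -> {mpoly (Cq R Q)[#|root_index r|]}),
      schurQ R mu =
        \sum_(1 <= n < N.+1) chern_eval (P n) * RH (@schurQ R Q r i) n mu.
Proof.
split=> [v|i mu mu_part mu_wide]; last first.
  exact (rim_hook_expansion R r_source fanoQ s_gt_r (r_pos _) mu_part mu_wide).
have [c cE] := schur_product_span acyclicQ r_source fanoQ s_gt_r v.
exists c; split=> // c' c'E; apply/ffunP => l; apply/eqP; rewrite -GRing.subr_eq0; apply/eqP.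
have diff0 : \sum_l (c l - c' l) *: schur_product R l = 0.
  rewrite (eq_bigr _ (fun l _ => scalerBl (c l) (c' l) (schur_product R l))).
  by rewrite sumrB -cE -c'E subrr.
exact: (schur_product_free acyclicQ r_source fanoQ s_gt_r diff0).
Qed.
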